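(* Let $R$ be a local Cohen-Macaulay ring, let $I\subset R$ be an ideal of positive codimension, and let $t\ge0$ be an integer. If the truncated Rees ring $\mathcal R(I)/\mathcal R(I)_{\ge t+2}$ is Gorenstein, then so is the truncated associated graded ring $\operatorname{gr}_I(R)/\operatorname{gr}_I(R)_{\ge t+1}$ and the ring $R/I^{t+1}$.
   Context: $\mathcal R(I)=\bigoplus_{j\ge0}I^j$ is the Rees algebra and $\operatorname{gr}_I(R)=\bigoplus_{j\ge0}I^j/I^{j+1}$ the associated graded ring; so $\mathcal R(I)/\mathcal R(I)_{\ge t+2}=R\oplus I\oplus\cdots\oplus I^{t+1}$ and $\operatorname{gr}_I(R)/\operatorname{gr}_I(R)_{\ge t+1}=R/I\oplus I/I^2\oplus\cdots\oplus I^t/I^{t+1}$. Codimension of an ideal means height. *)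

(* Defs.v *)
From HB Require Import structures.
From mathcomp Require Import all_boot all_algebra.
From mathcomp Require Import boolp classical_sets.

Set Implicit Arguments.
Unset Strict Implicit.
Unset Printing Implicit Defensive.

Import GRing.Theory.
Local Open Scope ring_scope.
Local Open Scope classical_set_scope.
Local Open Scope quotient_scope.

(* The unit ideal is allowed, so quotients are only [comPzRingType]s;
   [idealr] and [{ideal_quot _}] of the library cover proper ideals only. *)
Record ideal (A : comPzRingType) := Ideal {
  ideal_set :> A -> Prop;
  ideal0 : ideal_set 0;
  idealD : forall x y, ideal_set x -> ideal_set y -> ideal_set (x + y);
  idealMl : forall a x, ideal_set x -> ideal_set (a * x) }.

Section IdealTheory.
Variable A : comPzRingType.
Implicit Types I J : ideal A.

Lemma idealN I x : I x -> I (- x).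
Proof. by move=> Ix; rewrite -mulN1r; apply: idealMl. Qed.

Lemma idealB I x y : I x -> I y -> I (x - y).
Proof. by move=> Ix Iy; apply: idealD => //; apply: idealN. Qed.

Lemma ideal_sum I (T : Type) (s : seq T) (F : T -> A) :
  (forall i, I (F i)) -> I (\sum_(i <- s) F i).
Proof.
move=> IF; elim: s => [|i s IHs]; first by rewrite big_nil; apply: ideal0.
by rewrite big_cons; apply: idealD.
Qed.

Lemma unit_ideal0 : [set: A] 0. Proof. by []. Qed.
Lemma unit_idealD x y : [set: A] x -> [set: A] y -> [set: A] (x + y).
Proof. by []. Qed.
Lemma unit_idealMl a x : [set: A] x -> [set: A] (a * x). Proof. by []. Qed.

Definition unit_ideal : ideal A := Ideal unit_ideal0 unit_idealD unit_idealMl.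

Definition ideal_mul_set I J : set A :=
  [set x | exists2 s : seq (A * A),
     (forall p, p \in s -> I p.1 /\ J p.2) & x = \sum_(p <- s) p.1 * p.2].

Lemma ideal_mul0 I J : ideal_mul_set I J 0.
Proof. by exists [::] => //; rewrite big_nil. Qed.

Lemma ideal_mulD I J x y :
  ideal_mul_set I J x -> ideal_mul_set I J y -> ideal_mul_set I J (x + y).
Proof.
move=> [s sP ->] [u uP ->]; exists (s ++ u); last by rewrite big_cat.
by move=> p; rewrite mem_cat => /orP[/sP|/uP].
Qed.

Lemma ideal_mulMl I J a x : ideal_mul_set I J x -> ideal_mul_set I J (a * x).
Proof.
move=> [s sP ->]; exists [seq (a * p.1, p.2) | p <- s].
  by move=> _ /mapP[p /sP[Ip Jp] ->]; split=> //=; apply: idealMl.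
by rewrite big_map big_distrr; apply: eq_bigr => p _ /=; rewrite mulrA.
Qed.

Definition ideal_mul I J : ideal A :=
  Ideal (ideal_mul0 I J) (@ideal_mulD I J) (@ideal_mulMl I J).

Definition ideal_pow I (n : nat) : ideal A := iter n (ideal_mul I) unit_ideal.

Lemma ideal_powM I m n x y :
  ideal_pow I m x -> ideal_pow I n y -> ideal_pow I (m + n) (x * y).
Proof.
elim: m x y => [|m IHm] x y.
  by rewrite add0n => _; apply: idealMl.
rewrite addSn => -[s sP ->] Iy; rewrite mulr_suml.
exists [seq (p.1, p.2 * y) | p <- s].
  by move=> _ /mapP[p /sP[Ip Jp] ->]; split=> //=; apply: IHm.
by rewrite big_map; apply: eq_bigr => p _ /=; rewrite mulrA.
Qed.

Definition gen (s : seq A) : set A :=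
  [set x | exists c : 'I_(size s) -> A, x = \sum_(i < size s) c i * s`_i].

Definition prime_ideal I : Prop :=
  ~ I 1 /\ forall x y, I (x * y) -> I x \/ I y.

Definition maximal_ideal I : Prop :=
  ~ I 1 /\ forall J, I `<=` J -> ~ J 1 -> J `<=` I.

Definition noetherian : Prop :=
  forall I, exists s : seq A, (I : set A) = gen s.

Definition is_local_at (m : ideal A) : Prop :=
  maximal_ideal m /\
  forall m', maximal_ideal m' -> (m' : set A) = (m : set A).

(* P 0 < P 1 < ... < P n; the values of P beyond n are irrelevant. *)
Definition prime_chain (n : nat) (P : nat -> ideal A) : Prop :=
  (forall i, (i <= n)%N -> prime_ideal (P i)) /\
  (forall i, (i < n)%N -> P i `<=` P i.+1 /\ ~ (P i.+1 `<=` P i)).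

Definition is_max (S : set nat) (d : nat) : Prop :=
  S d /\ forall k, S k -> (k <= d)%N.

Definition krull_dim_eq (d : nat) : Prop :=
  is_max [set n | exists P, prime_chain n P] d.

(* The height of the prime P is at least n. *)
Definition height_ge (P : ideal A) (n : nat) : Prop :=
  exists2 Q, prime_chain n Q & (Q n : set A) = (P : set A).

(* The codimension (height) of I is the infimum of the heights of the primes
   containing I; it is infinite for the unit ideal. *)
Definition codim_ge I (n : nat) : Prop :=
  forall P, prime_ideal P -> I `<=` P -> height_ge P n.

Definition regular_sequence (s : seq A) : Prop :=
  ~ gen s 1 /\
  forall i, (i < size s)%N ->
    forall y, gen (take i s) (s`_i * y) -> gen (take i s) y.

Definition depth_eq (m : ideal A) (d : nat) : Prop :=
  is_max [set n | exists s : seq A,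
    [/\ size s = n, forall x, x \in s -> m x & regular_sequence s]] d.

Definition local_cohen_macaulay : Prop :=
  noetherian /\
  exists m d, [/\ is_local_at m, krull_dim_eq d & depth_eq m d].

Definition injective_module (E : lmodType A) : Prop :=
  forall (M N : lmodType A) (i : {linear M -> N}) (f : {linear M -> E}),
    injective i -> exists g : {linear N -> E}, forall x, g (i x) = f x.

(* An injective resolution 0 -> M -> E 0 -> E 1 -> ... with E i = 0 for i > n. *)
Definition injdim_le (M : lmodType A) (n : nat) : Prop :=
  exists (E : nat -> lmodType A) (e : {linear M -> E 0%N})
         (d : forall i, {linear E i -> E i.+1}),
    [/\ forall i, injective_module (E i),
        injective e,
        forall x, d 0%N x = 0 <-> exists y, e y = x,
        forall i x, d i.+1 x = 0 <-> exists y, d i y = x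
      & forall i, (n < i)%N -> forall x : E i, x = 0].

(* For a local ring this is the usual definition of a Gorenstein ring; it also
   makes the zero ring Gorenstein. *)
Definition gorenstein : Prop :=
  noetherian /\ exists n, injdim_le A^o n.

End IdealTheory.

Arguments noetherian A : clear implicits.
Arguments local_cohen_macaulay A : clear implicits.
Arguments gorenstein A : clear implicits.

Section Quotient.
Variables (A : comPzRingType) (I : ideal A).

Definition ideal_mem : {pred A} := fun x => `[< I x >].

Fact ideal_mem_zmod : zmod_closed ideal_mem.
Proof.
split=> [|x y]; rewrite !unfold_in; first by apply/asboolP; apply: ideal0.
by move=> /asboolP Ix /asboolP Iy; apply/asboolP; apply: idealB.
Qed.

HB.instance Definition _ := GRing.isZmodClosed.Build A ideal_mem ideal_mem_zmod.

Definition quo := @Quotient.quot A ideal_mem.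

HB.instance Definition _ := GRing.Zmodule.on quo.
HB.instance Definition _ :=
  EqQuotient.copy quo (@Quotient.quot A ideal_mem).

Definition quo_pi (x : A) : quo := \pi_quo x.

Lemma quo_pi_surj (u : quo) : exists x, quo_pi x = u.
Proof. by exists (repr u); rewrite /quo_pi reprK. Qed.

Lemma quo_piE x y : quo_pi x = quo_pi y <-> I (x - y).
Proof.
have := @Quotient.idealrBE A ideal_mem x y; rewrite unfold_in => xyE.
split=> [xy|Ixy]; first by apply/asboolP; rewrite [asbool _]xyE; apply/eqP.
by apply/eqP; rewrite -[_ == _]xyE; apply/asboolP.
Qed.

Lemma quo_piB x y : quo_pi (x - y) = quo_pi x - quo_pi y.
Proof. exact: (raddfB (\pi_(@Quotient.quot A ideal_mem))). Qed.

Lemma quo_piD x y : quo_pi (x + y) = quo_pi x + quo_pi y.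
Proof. exact: (raddfD (\pi_(@Quotient.quot A ideal_mem))). Qed.

Definition quo_mul (u v : quo) : quo := quo_pi (repr u * repr v).

Lemma quo_piM x y : quo_pi (x * y) = quo_mul (quo_pi x) (quo_pi y).
Proof.
have rP z : I (z - repr (quo_pi z)) by apply/quo_piE; rewrite /quo_pi reprK.
apply/quo_piE; move: (rP x) (rP y).
set x' := repr (quo_pi x); set y' := repr (quo_pi y) => Ix Iy.
have -> : x * y - x' * y' = y * (x - x') + x' * (y - y').
  by rewrite !mulrBr [y * x]mulrC [y * x']mulrC addrA subrK.
by apply: idealD; apply: idealMl.
Qed.

Fact quo_mulA : associative quo_mul.
Proof.
move=> u v w; have [x <-] := quo_pi_surj u.
have [[y <-] [z <-]] := (quo_pi_surj v, quo_pi_surj w).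
by rewrite -!quo_piM mulrA.
Qed.

Fact quo_mulC : commutative quo_mul.
Proof. by move=> u v; rewrite /quo_mul mulrC. Qed.

Fact quo_mul1 : left_id (quo_pi 1) quo_mul.
Proof. by move=> u; have [x <-] := quo_pi_surj u; rewrite -quo_piM mul1r. Qed.

Fact quo_mulDl : left_distributive quo_mul +%R.
Proof.
move=> u v w; have [x <-] := quo_pi_surj u.
have [[y <-] [z <-]] := (quo_pi_surj v, quo_pi_surj w).
by rewrite -quo_piD -!quo_piM -quo_piD mulrDl.
Qed.

HB.instance Definition _ := GRing.Zmodule_isComPzRing.Build quo
  quo_mulA quo_mulC quo_mul1 quo_mulDl.

HB.instance Definition _ := GRing.isZmodMorphism.Build A quo quo_pi quo_piB.
HB.instance Definition _ := GRing.isMonoidMorphism.Build A quo quo_pi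
  (erefl, quo_piM).

Variable J : ideal A.

(* (J + I) / I *)
Definition quo_ideal_set : set quo := quo_pi @` J.

Lemma quo_ideal0 : quo_ideal_set 0.
Proof. by exists 0; [apply: ideal0 | rewrite rmorph0]. Qed.

Lemma quo_idealD u v :
  quo_ideal_set u -> quo_ideal_set v -> quo_ideal_set (u + v).
Proof.
by move=> [x Jx <-] [y Jy <-]; exists (x + y); [apply: idealD | rewrite rmorphD].
Qed.

Lemma quo_idealMl a u : quo_ideal_set u -> quo_ideal_set (a * u).
Proof.
have [b <-] := quo_pi_surj a.
by move=> [x Jx <-]; exists (b * x); [apply: idealMl | rewrite rmorphM].
Qed.

Definition quo_ideal : ideal quo := Ideal quo_ideal0 quo_idealD quo_idealMl.

End Quotient.

Section Rees.
Variables (R : comNzRingType) (I : ideal R).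

(* The Rees algebra as the subring of R[T] of the polynomials whose coefficient
   of T^j lies in I^j. *)
Definition rees_mem : {pred {poly R}} :=
  fun p => `[< forall j, ideal_pow I j p`_j >].

Lemma rees_memP (p : {poly R}) : reflect (forall j, ideal_pow I j p`_j) (p \in rees_mem).
Proof. exact: asboolP. Qed.

Fact rees_subring : subring_closed rees_mem.
Proof.
split=> [|p q /rees_memP Ip /rees_memP Iq|p q /rees_memP Ip /rees_memP Iq].
- apply/rees_memP=> -[|j] //.
  by rewrite coef1; apply: ideal0.
- by apply/rees_memP=> j; rewrite coefB; apply: idealB.
- apply/rees_memP=> j; rewrite coefM; apply: ideal_sum => i.
  by rewrite -{1}(subnKC (leq_ord i)); apply: ideal_powM.
Qed.

HB.instance Definition _ :=
  GRing.isSubringClosed.Build {poly R} rees_mem rees_subring.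

Record rees := ReesElt { rees_poly :> {poly R}; rees_polyP : rees_poly \in rees_mem }.

HB.instance Definition _ := [isSub for rees_poly].
HB.instance Definition _ := [Choice of rees by <:].
HB.instance Definition _ := [SubChoice_isSubComNzRing of rees by <:].

(* R(I)_{>= n}, the elements with no component in degree < n *)
Definition rees_ge_set (n : nat) : set rees :=
  [set p | forall j, (j < n)%N -> (rees_poly p)`_j = 0].

Lemma rees_ge0 n : rees_ge_set n 0.
Proof. by move=> j _; rewrite coef0. Qed.

Lemma rees_geD n p q :
  rees_ge_set n p -> rees_ge_set n q -> rees_ge_set n (p + q).
Proof. by move=> p0 q0 j jn; rewrite coefD p0 // q0 // addr0. Qed.

Lemma rees_geMl n a p : rees_ge_set n p -> rees_ge_set n (a * p).
Proof.
move=> p0 j jn; rewrite coefM big1 // => i _.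
by rewrite p0 ?mulr0 // (leq_ltn_trans (leq_subr _ _)).
Qed.

Definition rees_ge (n : nat) : ideal rees :=
  Ideal (@rees_ge0 n) (@rees_geD n) (@rees_geMl n).

(* The ideal I R(I), that is, the direct sum of the I^(j+1) in degree j. *)
Definition rees_shift_set : set rees :=
  [set p | forall j, ideal_pow I j.+1 (rees_poly p)`_j].

Lemma rees_shift0 : rees_shift_set 0.
Proof. by move=> j; rewrite coef0; apply: ideal0. Qed.

Lemma rees_shiftD p q :
  rees_shift_set p -> rees_shift_set q -> rees_shift_set (p + q).
Proof. by move=> Ip Iq j; rewrite coefD; apply: idealD. Qed.

Lemma rees_shiftMl a p : rees_shift_set p -> rees_shift_set (a * p).
Proof.
move=> Ip j; rewrite coefM; apply: ideal_sum => i.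
rewrite -{1}(subnKC (leq_ord i)) -addnS.
by apply: ideal_powM; [apply/rees_memP/rees_polyP | apply: Ip].
Qed.

Definition rees_shift : ideal rees := Ideal rees_shift0 rees_shiftD rees_shiftMl.

(* gr_I(R), the direct sum of the I^j / I^(j+1) *)
Definition gr := quo rees_shift.

(* gr_I(R)_{>= n}, the image of R(I)_{>= n} *)
Definition gr_ge (n : nat) : ideal gr := quo_ideal rees_shift (rees_ge n).

Definition truncated_rees (n : nat) := quo (rees_ge n).

Definition truncated_gr (n : nat) := quo (gr_ge n).

End Rees.

(* Main.v *)
From HB Require Import structures.
Require Import Defs.
From mathcomp Require Import all_boot all_algebra.
From mathcomp Require Import boolp classical_sets.

Set Implicit Arguments.
Unset Strict Implicit.
Unset Printing Implicit Defensive.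

Import GRing.Theory.
Local Open Scope ring_scope.
Local Open Scope classical_set_scope.

(** Write [S = R + I + ... + I^(t+1)] for the truncated Rees ring. It is a local
    ring, and both rings of the conclusion are quotients [S / K]. In each case [K]
    contains an ideal [J = S_(>= q)], where [q] is [t + 1] for the associated
    graded ring and 1 for [R / I^(t+1)], and [K / J] is isomorphic to
    [J' = S_(>= q')] with [q + q' = t + 2], through multiplication by the first,
    respectively the last, power of the variable.

    As [R] is Cohen-Macaulay and [I] has positive codimension, no nonzero element
    of [R] kills [I] ([cohen_macaulay_annihilator]); hence each of [J] and [J'] is
    the annihilator of the other ([tail_annihilator]).

    The injective dimension of [S] is at most the length of a maximal regular sequence
    ([injective_dimension_depth]), and prime avoidance lets one take this sequence
    in the maximal ideal of [R]. Over [R] the modules [S / J] and [S / J'] are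
    direct summands of [S], so the sequence is regular on them too, and Nakayama's
    lemma gives [Ext^i (S / J, S) = Ext^i (S / J', S) = 0] for [i > 0]
    ([ext_zero_summand]).

    Therefore [Hom (S / J, S) = J'] and [Hom (J', S) = S / J], while the higher
    Ext of [S / J] and of [J'] into [S] vanish. The exact sequence of [K / J],
    [S / J] and [S / K] then says that [Ext^i (S / K, S)] is [S / K] for [i = 1]
    and vanishes for the other [i] ([linkage_ext0], [linkage_ext1],
    [linkage_ext_ge2]). If [E] is a finite injective resolution of [S], then
    [Hom (S / K, E)] is a finite complex of injective [S / K]-modules whose only
    cohomology is [S / K] in degree 1; it yields a finite injective resolution of
    [S / K] ([injdim_le_quotient]).

    Apart from [J'] all these modules are cyclic, so Ext needs no general theory:
    [Ext^i (A / J, A)] is the cohomology of the submodules of [E] killed by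
    [J], and the long exact sequences are those of
    [0 -> A / (J : a) -> A / J -> A / (J + (a)) -> 0]. *)

#[local] Obligation Tactic := idtac.

(** * Ideals of a Noetherian ring *)

Section Ideals.
Variable A : comPzRingType.
Implicit Types (I J L : ideal A) (x y u v : A) (s : seq A).

Program Definition zero_ideal : ideal A := @Ideal A [set x | x = 0] _ _ _.
Next Obligation. by []. Qed.
Next Obligation. by move=> x y -> ->; rewrite addr0. Qed.
Next Obligation. by move=> a x ->; rewrite mulr0. Qed.

(** The ideal [J + (x)], in the form that the long exact sequences use. *)
Program Definition ideal_adjoin J x : ideal A :=
  @Ideal A [set u | exists a, J (u - a * x)] _ _ _.
Next Obligation. by move=> J x; exists 0; rewrite mul0r subr0; apply: ideal0. Qed.
Next Obligation.
move=> J x u v [a Ju] [b Jv]; exists (a + b).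
by rewrite mulrDl opprD addrACA; apply: idealD.
Qed.
Next Obligation.
move=> J x c u [a Ju]; exists (c * a).
by rewrite -mulrA -mulrBr; apply: idealMl.
Qed.

Program Definition colon J x : ideal A := @Ideal A [set a | J (a * x)] _ _ _.
Next Obligation. by move=> J x /=; rewrite mul0r; apply: ideal0. Qed.
Next Obligation. by move=> J x a b Ja Jb /=; rewrite mulrDl; apply: idealD. Qed.
Next Obligation. by move=> J x c a Ja /=; rewrite -mulrA; apply: idealMl. Qed.

Fixpoint adjoin J s : ideal A :=
  if s is x :: s' then adjoin (ideal_adjoin J x) s' else J.

Lemma ideal_adjoinl J x u : J u -> ideal_adjoin J x u.
Proof. by move=> Ju; exists 0; rewrite mul0r subr0. Qed.

Lemma ideal_adjoinr J x : ideal_adjoin J x x.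
Proof. by exists 1; rewrite mul1r subrr; apply: ideal0. Qed.

Lemma ideal_adjoin_min J L x : J `<=` L -> L x -> ideal_adjoin J x `<=` L.
Proof.
move=> JL Lx u [a Ju]; rewrite -(subrK (a * x) u).
by apply: idealD; [apply: JL | apply: idealMl].
Qed.

Lemma adjoinl J s u : J u -> adjoin J s u.
Proof.
elim: s J => //= x s IHs J Ju.
by apply: IHs; apply: ideal_adjoinl.
Qed.

Lemma adjoinr J s x : x \in s -> adjoin J s x.
Proof.
elim: s J => //= y s IHs J; rewrite in_cons => /orP[/eqP ->|]; last exact: IHs.
by apply: adjoinl; apply: ideal_adjoinr.
Qed.

Lemma adjoin_min J L s : J `<=` L -> (forall x, x \in s -> L x) ->
  adjoin J s `<=` L.
Proof.
elim: s J => //= x s IHs J JL sL; apply: IHs.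
  by apply: ideal_adjoin_min => //; apply: sL; rewrite mem_head.
by move=> y ys; apply: sL; rewrite in_cons ys orbT.
Qed.

Lemma adjoin_rcons J s x :
  (adjoin J (rcons s x) : set A) = ideal_adjoin (adjoin J s) x.
Proof. by elim: s J => //= y s IHs J; rewrite IHs. Qed.

Lemma gen_adjoin s : gen s = adjoin zero_ideal s.
Proof.
apply/seteqP; split=> [x [c ->]|x].
  apply: ideal_sum => i; apply: idealMl; apply: adjoinr; exact: mem_nth.
elim/last_ind: s x => [|s y IHs] x; first by move=> ->; exists (fun=> 0); rewrite big_ord0.
rewrite adjoin_rcons => -[a /IHs[c xE]].
pose c' k := if insub k is Some i then c i else a.
exists (fun i => c' i); rewrite -(subrK (a * y) x) xE size_rcons big_ord_recr /=.
rewrite nth_rcons ltnn eqxx {2}/c' insubN ?ltnn //; congr (_ + _).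
apply: eq_bigr => i _; rewrite nth_rcons ltn_ord; congr (_ * _).
by rewrite /c' /= valK.
Qed.

Lemma ideal_eqP I J : (I : set A) = J -> I = J.
Proof.
case: I J => I I0 ID IM [J J0 JD JM] /= IJ; subst J.
by congr Ideal; apply: Prop_irrelevance.
Qed.

Hypothesis noethA : noetherian A.

Lemma noetherian_adjoin J : exists s, (J : set A) = adjoin zero_ideal s.
Proof. by have [s ->] := noethA J; exists s; rewrite gen_adjoin. Qed.

(** A counterexample would have counterexamples strictly above it for ever;
    finitely many generators of the union of such a chain already lie in one of
    its terms. *)
Lemma noetherian_ind (P : ideal A -> Prop) :
  (forall J, (forall L, J `<=` L -> ~ (L `<=` J) -> P L) -> P J) -> forall J, P J.
Proof.
move=> indP J0; apply: contrapT => badJ0.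
have step (J : {J | ~ P J}) :
    {L : {J | ~ P J} | sval J `<=` sval L /\ ~ (sval L `<=` sval J)}.
  apply: cid; case: J => J badJ; apply: contrapT => noL; apply: (badJ).
  apply: indP => L JL LJ; apply: contrapT => badL.
  by apply: noL; exists (exist _ L badL).
pose F (K : {J | ~ P J}) := sval (step K); pose c n : ideal A := sval (iter n F (exist _ J0 badJ0)).
have cS n : c n `<=` c n.+1 /\ ~ (c n.+1 `<=` c n).
  by rewrite /c /= /F; case: (step _).
have c_le m n : (m <= n)%N -> c m `<=` c n.
  move=> /subnKC <-; elim: (n - m)%N => [|k IHk]; first by rewrite addn0.
  by rewrite addnS => x /IHk; apply: (cS _).1.
pose U : set A := [set x | exists n, c n x].
have U0 : U 0 by exists 0%N; apply: ideal0.
have UD x y : U x -> U y -> U (x + y).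
  move=> [m cx] [n cy]; exists (maxn m n); apply: idealD.
    by apply: c_le cx; apply: leq_maxl.
  by apply: c_le cy; apply: leq_maxr.
have UM a x : U x -> U (a * x) by move=> [n cx]; exists n; apply: idealMl.
have [s sE] := noetherian_adjoin (Ideal U0 UD UM).
have [n ns] : exists n, forall x, x \in s -> c n x.
  have: forall x, x \in s -> U x by move=> x xs; rewrite -/(Ideal U0 UD UM x) sE; apply: adjoinr.
  elim: s {sE} => [|x s IHs] sU; first by exists 0%N.
  have [|n ns] := IHs; first by move=> y ys; apply: sU; rewrite in_cons ys orbT.
  have [m cx] := sU x (mem_head _ _); exists (maxn m n) => y.
  rewrite in_cons => /orP[/eqP ->|/ns cy]; first by apply: c_le cx; apply: leq_maxl.
  by apply: c_le cy; apply: leq_maxr.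
apply: (cS n).2 => x cx; have: U x by exists n.+1.
rewrite -/(Ideal U0 UD UM x) sE; apply: adjoin_min => //.
by move=> _ ->; apply: ideal0.
Qed.

(** ** Associated primes and prime avoidance *)

(** A maximal annihilator of a nonzero element of [A / J] is prime: these are the
    associated primes that the proofs below use. *)
Definition max_colon J u : Prop :=
  ~ J u /\ forall v, ~ J v -> colon J u `<=` colon J v -> colon J v `<=` colon J u.

Lemma max_colon_prime J u : max_colon J u -> prime_ideal (colon J u).
Proof.
move=> [Ju maxu]; split=> [|a b]; first by rewrite /= mul1r.
move=> Jabu; have [Jbu|Jbu] := pselect (J (b * u)); [by right | left].
apply: (maxu (b * u)) => //=; last by rewrite mulrA.
by move=> c /= Jcu; rewrite mulrCA; apply: idealMl.
Qed.

Lemma max_colon_above J u :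
  ~ J u -> exists2 v, max_colon J v & colon J u `<=` colon J v.
Proof.
move=> Ju; pose P L := forall u, ~ J u -> colon J u = L ->
  exists2 v, max_colon J v & colon J u `<=` colon J v.
suff: P (colon J u) by apply.
apply: noetherian_ind => {u Ju} L IHL u Ju uL.
have [maxu|] := pselect (max_colon J u); first by exists u.
move=> nmaxu; have [v [Jv uv vu]] :
    exists v, [/\ ~ J v, colon J u `<=` colon J v & ~ (colon J v `<=` colon J u)].
  apply: contrapT => nov; apply: nmaxu; split=> // v Jv uv.
  by apply: contrapT => vu; apply: nov; exists v.
rewrite -uL in IHL; have [w maxw vw] := IHL _ uv vu v Jv erefl.
by exists w => // a /uv/vw.
Qed.

(** The elements with maximal annihilators generate an ideal modulo [J], and
    finitely many of them generate it. *)
Lemma max_colon_finite J : exists s, (forall u, u \in s -> max_colon J u) /\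
  (forall v, max_colon J v -> adjoin J s v).
Proof.
pose P L := forall s, (forall u, u \in s -> max_colon J u) -> adjoin J s = L ->
  exists s, (forall u, u \in s -> max_colon J u) /\
    (forall v, max_colon J v -> adjoin J s v).
suff: P J by move/(_ [::]); apply.
apply: noetherian_ind => L IHL s smax sL.
have [all_v|] := pselect (forall v, max_colon J v -> adjoin J s v); first by exists s.
move=> /existsNP[v /not_implyP[maxv sv]].
apply: (IHL (adjoin J (v :: s)) _ _ (v :: s)) => //; rewrite -?sL.
- apply: adjoin_min => [x Jx|x xs]; first exact: adjoinl.
  by apply: adjoinr; rewrite in_cons xs orbT.
- by move/(_ v); apply: contra_not sv; apply; apply: adjoinr; apply: mem_head.
- by move=> u; rewrite in_cons => /orP[/eqP -> //|]; apply: smax.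
Qed.

(** Finitely many associated primes cover the zero divisors modulo [J]: any other
    [v] with maximal annihilator is a combination of the chosen generators, so its
    annihilator contains the intersection of theirs, hence equals one of them. *)
Lemma zero_divisor_colon J : exists s, (forall u, u \in s -> max_colon J u) /\
  forall a v, ~ J v -> J (a * v) -> exists2 u, u \in s & J (a * u).
Proof.
have [s [smax sall]] := max_colon_finite J; exists s; split=> // a v' Jv' av'.
have [v maxv /(_ _ av')/= av] := max_colon_above Jv'.
suff [u us uv] : exists2 u, u \in s & colon J u `<=` colon J v.
  by exists u => //; apply: ((smax u us).2 v maxv.1 uv).
apply: contrapT => nou.
have [b bs] : exists2 b, forall u, u \in s -> J (b * u) & ~ J (b * v).
  have: forall u, u \in s -> exists2 b, J (b * u) & ~ J (b * v).
    move=> u us; apply: contrapT => nob; apply: nou; exists u => // b Jbu.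
    by apply: contrapT => Jbv; apply: nob; exists b.
  elim: (s) => [|u r IHr] rP; first by exists 1 => //; rewrite mul1r; case: maxv.
  have [|b br bv] := IHr; first by move=> w wr; apply: rP; rewrite in_cons wr orbT.
  have [c cu cv] := rP u (mem_head _ _); exists (c * b) => [w|].
    rewrite in_cons => /orP[/eqP ->|/br bw]; last by rewrite -mulrA; apply: idealMl.
    by rewrite [c * b]mulrC -mulrA; apply: idealMl.
  by case/(max_colon_prime maxv).2.
apply; have: adjoin J s `<=` colon J b.
  by apply: adjoin_min => [x Jx|x xs] /=; [rewrite mulrC; apply: idealMl | rewrite mulrC; apply: bs].
by move/(_ _ (sall v maxv)) => /=; rewrite mulrC.
Qed.

(** Stated for a set closed under sums and products, because below it is the image
    of the maximal ideal of a subring. *)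
Lemma prime_avoidance J (T : set A) s :
  T 0 -> (forall x y, T x -> T y -> T (x + y)) ->
  (forall x y, T x -> T y -> T (x * y)) ->
  (forall u, u \in s -> prime_ideal (colon J u)) ->
  (forall u, u \in s -> exists2 x, T x & ~ J (x * u)) ->
  exists2 x, T x & forall u, u \in s -> ~ J (x * u).
Proof.
move=> T0 TD TM; move: {2}(size s).+1 (ltnSn (size s)) => n.
elim: n s => // n IHn [|u s]; first by exists 0.
rewrite ltnS /= => sn sprime sT.
(* Discard the primes whose intersection with T lies in the first one: they
   are avoided as soon as the first one is. *)
pose s' := [seq v <- s | `[< exists x, [/\ T x, J (x * v) & ~ J (x * u)] >]].
have ss' v : v \in s -> v \notin s' -> forall x, T x -> J (x * v) -> J (x * u).
  move=> vs; rewrite mem_filter vs andbT => /asboolP vP x Tx Jxv.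
  by apply: contrapT => Jxu; apply: vP; exists x.
have s's v : v \in s' -> v \in u :: s.
  by rewrite mem_filter in_cons => /andP[_ ->]; rewrite orbT.
have [|||x Tx xs'] := IHn s' _ _ _.
- by rewrite (leq_ltn_trans _ sn) // size_filter count_size.
- by move=> v /s's; apply: sprime.
- by move=> v /s's; apply: sT.
suff [y Ty [yu ys']] : exists2 y, T y & ~ J (y * u) /\ forall v, v \in s' -> ~ J (y * v).
  exists y => // v; rewrite in_cons => /orP[/eqP -> //|vs].
  by have [/ys' //|vs'] := boolP (v \in s'); move/(ss' _ vs vs' _ Ty).
have [Jxu|] := pselect (J (x * u)); last by exists x.
have uprime : prime_ideal (colon J u) by apply: sprime; apply: mem_head.
have [z Tz [zu zs']] : exists2 z, T z & ~ J (z * u) /\ forall v, v \in s' -> J (z * v).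
  have: forall v, v \in s' -> exists x, [/\ T x, J (x * v) & ~ J (x * u)].
    by move=> v; rewrite mem_filter => /andP[/asboolP].
  elim: (s') => [|v r IHr] rP; first by have [z] := sT u (mem_head _ _); exists z.
  have [|z Tz [zu zr]] := IHr; first by move=> w wr; apply: rP; rewrite in_cons wr orbT.
  have [y [Ty yv yu]] := rP v (mem_head _ _); exists (y * z); first exact: TM.
  split=> [|w]; first by case/uprime.2.
  rewrite in_cons => /orP[/eqP ->|/zr zw]; last by rewrite -mulrA; apply: idealMl.
  by rewrite [y * z]mulrC -mulrA; apply: idealMl.
exists (x + z); first exact: TD.
split=> [|v vs']; rewrite mulrDl => Jxz.
  by apply: zu; rewrite -[_ * u](addKr (x * u)); apply: idealD => //; apply: idealN.
by apply: (xs' v vs'); rewrite -[_ * v](addrK (z * v)); apply: idealB => //; apply: zs'.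
Qed.

(** A set of zero divisors that is closed under sums and products lies in one of
    the finitely many associated primes, by prime avoidance. *)
Lemma zero_divisors_killed J (T : set A) :
  T 0 -> (forall x y, T x -> T y -> T (x + y)) ->
  (forall x y, T x -> T y -> T (x * y)) ->
  (forall x, T x -> exists2 u, ~ J u & J (x * u)) ->
  exists2 u, max_colon J u & T `<=` colon J u.
Proof.
move=> T0 TD TM Tzd; have [s [smax szd]] := zero_divisor_colon J.
apply: contrapT => nou.
have [||x Tx xs] := @prime_avoidance J T s T0 TD TM.
- by move=> u /smax/max_colon_prime.
- move=> u us; apply: contrapT => nox; apply: nou; exists u; first exact: smax.
  by move=> x Tx; apply: contrapT => /= Jxu; apply: nox; exists x.
have [u Ju Jxu] := Tzd x Tx; have [v vs] := szd x u Ju Jxu; exact: xs.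
Qed.

End Ideals.

(** ** Regular sequences and local rings *)

Section LocalRings.
Variable A : comPzRingType.
Implicit Types (J : ideal A) (T : set A) (s : seq A).

(** The quotient by the sequence may vanish: this is weak regularity. *)
Fixpoint regular_in (T : set A) J s : Prop :=
  if s is x :: s' then (T x /\ colon J x `<=` J) /\ regular_in T (ideal_adjoin J x) s'
  else True.

Lemma regular_in_nth T J s : (forall x, x \in s -> T x) ->
  (forall i, (i < size s)%N -> forall y,
     adjoin J (take i s) (s`_i * y) -> adjoin J (take i s) y) ->
  regular_in T J s.
Proof.
elim: s J => //= x s IHs J sT reg; split.
  split; first by apply: sT; rewrite mem_head.
  by move=> y /=; rewrite mulrC; apply: (reg 0%N).
apply: IHs => [y ys|i si]; first by apply: sT; rewrite in_cons ys orbT.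
exact: (reg i.+1).
Qed.

(** A ring is local with maximal ideal [m] when its elements outside the proper
    ideal [m] are invertible; this form is the easiest to check for the truncated
    Rees ring. *)
Section NonunitIdeal.
Variable m : ideal A.
Hypothesis m_proper : ~ m 1.
Hypothesis m_unit : forall x, ~ m x -> exists y, y * x = 1.

Lemma max_unit_1B a : m a -> forall b, exists c, c * (1 - a * b) = 1.
Proof.
move=> ma b; apply: m_unit => mab; apply: m_proper.
by rewrite -(subrK (a * b) 1); apply: idealD => //; rewrite mulrC; apply: idealMl.
Qed.

Lemma proper_sub_max J : ~ J 1 -> J `<=` m.
Proof.
move=> J1 x Jx; apply: contrapT => /m_unit[y yx]; apply: J1.
by rewrite -yx; apply: idealMl.
Qed.

End NonunitIdeal.

Hypothesis noethA : noetherian A.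

Lemma maximal_ideal_above J : ~ J 1 -> exists2 m, maximal_ideal m & J `<=` m.
Proof.
elim/(noetherian_ind noethA): J => J IHJ J1.
have [maxJ|] := pselect (maximal_ideal J); first by exists J.
move=> nmax; have [L [JL LJ L1]] : exists L : ideal A, [/\ J `<=` L, ~ (L `<=` J) & ~ L 1].
  apply: contrapT => noL; apply: nmax; split=> // L JL L1.
  by apply: contrapT => LJ; apply: noL; exists L.
by have [m maxm Lm] := IHJ L JL LJ L1; exists m => // x /JL/Lm.
Qed.

Variable m : ideal A.
Hypothesis local_m : is_local_at m.

Lemma local_proper : ~ m 1. Proof. by case: local_m => [[]]. Qed.

Lemma local_unit x : ~ m x -> exists y, y * x = 1.
Proof.
move=> mx; apply: contrapT => nounit.
have [|m' maxm' xm'] := @maximal_ideal_above (ideal_adjoin (zero_ideal A) x).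
  by move=> [a /= /eqP]; rewrite subr_eq0 => /eqP a1; apply: nounit; exists a.
by apply: mx; rewrite -(local_m.2 _ maxm'); apply: xm'; apply: ideal_adjoinr.
Qed.

End LocalRings.

(** * Finite generation and Nakayama's lemma *)

Section FiniteGeneration.
Variable A : comPzRingType.

(** Membership in the submodule generated by [s] and [B], by recursion on [s]. *)
Fixpoint span_mod (V : lmodType A) (B : V -> Prop) (s : seq V) (x : V) : Prop :=
  if s is y :: s' then exists a, span_mod B s' (x - a *: y) else B x.

Section Span.
Variables (V : lmodType A) (B : V -> Prop).
Hypothesis BP : forall c x y, B x -> B y -> B (c *: x + y).

Lemma span_modP s c x y :
  span_mod B s x -> span_mod B s y -> span_mod B s (c *: x + y).
Proof.
elim: s x y => [|z s IHs] x y /=; first exact: BP.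
move=> [a xa] [b yb]; exists (c * a + b).
have -> : c *: x + y - (c * a + b) *: z = c *: (x - a *: z) + (y - b *: z).
  by rewrite scalerDl scalerBr scalerA opprD addrACA.
exact: IHs.
Qed.

Lemma span_mod_sub s x : B x -> span_mod B s x.
Proof.
elim: s x => //= y s IHs x Bx; exists 0.
by rewrite scale0r subr0; apply: IHs.
Qed.

Lemma span_modS (C : V -> Prop) s x :
  (forall z, C z -> B z) -> span_mod C s x -> span_mod B s x.
Proof.
move=> CB; elim: s x => [|y s IHs] x /=; first exact: CB.
by move=> [a /IHs xa]; exists a.
Qed.

Lemma span_mod_rot s x y :
  span_mod (fun z => exists c, B (z - c *: y)) s x -> span_mod B (y :: s) x.
Proof.
elim: s x => //= z s IHs x [a /IHs[c xac]]; exists c, a.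
by rewrite addrAC.
Qed.

Lemma span_mod_cat (C : V -> Prop) s1 s2 x : (forall z, C z -> span_mod B s2 z) ->
  span_mod C s1 x -> span_mod B (s1 ++ s2) x.
Proof.
move=> CB; elim: s1 x => [|z s1 IHs] x /=; first exact: CB.
by move=> [a /IHs xa]; exists a.
Qed.

Lemma span_mod_replace (L : V -> Prop) s :
  (forall y, y \in s -> exists2 z, L z & B (y - z)) ->
  exists2 s', (forall z, z \in s' -> L z) & forall x, span_mod B s x -> span_mod B s' x.
Proof.
elim: s => [|y s IHs] sP; first by exists [::].
have [|s' s'L ss'] := IHs; first by move=> z zs; apply: sP; rewrite in_cons zs orbT.
have [z Lz yz] := sP y (mem_head _ _); exists (z :: s').
  by move=> x; rewrite in_cons => /orP[/eqP ->|/s'L].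
move=> x /= [a /ss' xa]; exists a.
have -> : x - a *: z = a *: (y - z) + (x - a *: y).
  by rewrite [RHS]addrC scalerBr addrA subrK.
by apply: span_modP => //; apply: span_mod_sub.
Qed.

Lemma span_mod_restrict (L : V -> Prop) s x :
  (forall c y z, L y -> L z -> L (c *: y + z)) -> (forall y, y \in s -> L y) ->
  L x -> span_mod B s x -> span_mod (fun y => B y /\ L y) s x.
Proof.
move=> LP; elim: s x => //= y s IHs x sL Lx [a xa]; exists a; apply: IHs => //.
  by move=> z zs; apply: sL; rewrite in_cons zs orbT.
by rewrite addrC -scaleNr; apply: LP => //; apply: sL; apply: mem_head.
Qed.

(** The first hypothesis puts [r] in the Jacobson radical, so that a generator [y]
    with [y = r *: z] modulo [B] can be eliminated. *)
Lemma nakayama (Z : V -> Prop) (r : A) s :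
  (forall a, exists b, b * (1 - r * a) = 1) ->
  (forall y, y \in s -> Z y) -> (forall x, Z x -> span_mod B s x) ->
  (forall x, Z x -> exists2 y, Z y & B (x - r *: y)) -> forall x, Z x -> B x.
Proof.
move=> unit_r; elim: s => //= y s IHs sZ Zs Zr; apply: IHs => //.
  by move=> z zs; apply: sZ; rewrite in_cons zs orbT.
suff sy : span_mod B s y.
  move=> x /Zs[a xa]; have := span_modP a sy xa.
  by rewrite subrKC.
have [z Zz zy] := Zr y (sZ y (mem_head _ _)); have [a za] := Zs z Zz.
have [b bE] := unit_r a.
have Bb : B (b *: (y - r *: z)).
  by rewrite -[b](subrK 1) scalerDl scale1r; apply: BP.
have -> : y = (b * r) *: (z - a *: y) + b *: (y - r *: z).
  rewrite -[LHS]scale1r -bE -!scalerA -scalerDr; congr (_ *: _).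
  by rewrite scalerBr addrACA addrAC subrKC addrC scalerBl scale1r scalerA.
by apply: span_modP => //; apply: span_mod_sub.
Qed.

End Span.

Lemma span_mod_linear (V W : lmodType A) (f : {linear V -> W}) (B : V -> Prop)
    (C : W -> Prop) s x :
  (forall y, B y -> C (f y)) -> span_mod B s x -> span_mod C [seq f y | y <- s] (f x).
Proof.
move=> BC; elim: s x => [|y s IHs] x /=; first exact: BC.
by move=> [a /IHs sa]; exists a; rewrite -linearZ -linearB.
Qed.

Lemma span_mod_adjoin (J : ideal A) s a : adjoin J s a -> span_mod (V := A^o) J s a.
Proof.
elim: s J a => //= x s IHs J a /IHs sa.
exact: (@span_mod_rot A^o J s a x).
Qed.

End FiniteGeneration.


(** * Baer's criterion *)

Section LinearRelation.
Variables (A : comPzRingType) (E : lmodType A) (G : A -> E -> Prop).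
Hypothesis G0 : G 0 0.
Hypothesis GP : forall c a b x y, G a x -> G b y -> G (c * a + b) (c *: x + y).

Definition relation_mem : {pred A^o * E} := fun p => `[< G p.1 p.2 >].

Fact relation_submod : submod_closed relation_mem.
Proof.
split=> [|c [a x] [b y]]; rewrite !unfold_in /=; first exact/asboolP.
by move=> /asboolP Gax /asboolP Gby; apply/asboolP; apply: GP.
Qed.

HB.instance Definition _ :=
  GRing.isSubmodClosed.Build A (A^o * E)%type relation_mem relation_submod.

Record relation := Relation { relation_val :> A^o * E; _ : relation_val \in relation_mem }.

HB.instance Definition _ := [isSub for relation_val].
HB.instance Definition _ := [Choice of relation by <:].
HB.instance Definition _ := [SubChoice_isSubLmodule of relation by <:].

Definition relation_fst (p : relation) : A^o := (relation_val p).1.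
Definition relation_snd (p : relation) : E := (relation_val p).2.

Fact relation_fst_linear : linear relation_fst. Proof. by []. Qed.
Fact relation_snd_linear : linear relation_snd. Proof. by []. Qed.

HB.instance Definition _ := GRing.isLinear.Build A relation A^o _ relation_fst
  relation_fst_linear.
HB.instance Definition _ := GRing.isLinear.Build A relation E _ relation_snd
  relation_snd_linear.

(** Baer's criterion for a linear map that is given by its graph. The maps to be
    extended below are defined on the image of another map, where a graph is
    easier to write down than a function. *)
Lemma injective_relation : injective_module E -> (forall x, G 0 x -> x = 0) ->
  exists w, forall a x, G a x -> x = a *: w.
Proof.
move=> injE G_fun.
have [|g gE] := injE relation A^o relation_fst relation_snd.
  move=> [[a x] Gax] [[b y] Gby]; move=> ab; have {}ab : a = b := ab; subst b.
  apply/val_inj => /=; congr pair; apply/eqP; rewrite -subr_eq0; apply/eqP.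
  apply: G_fun; move/asboolP: Gax => /= Gax; move/asboolP: Gby => /= Gby.
  by have := GP (-1) Gby Gax; rewrite mulN1r addNr scaleN1r addrC.
exists (g 1) => a x Gax.
have inG : (a, x) \in relation_mem by apply/asboolP.
have gax : g (a : A^o) = x := gE (Relation inG).
by rewrite -gax -linearZ; congr (g _); rewrite [_ *: _]mulr1.
Qed.

End LinearRelation.


(** * Cohomology of the torsion submodules of an injective resolution *)

Section Cohomology.
Variables (A : comPzRingType) (E : nat -> lmodType A).
Variables (e : {linear A^o -> E 0%N}) (d : forall i, {linear E i -> E i.+1}).
Hypothesis injE : forall i, injective_module (E i).
Hypothesis e_inj : injective e.
Hypothesis exact_e : forall x, d 0%N x = 0 <-> exists y, e y = x.
Hypothesis exact_d : forall i x, d i.+1 x = 0 <-> exists y, d i y = x.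
Implicit Types (J : ideal A) (a : A) (i : nat).

Lemma differential_square i (x : E i) : d i.+1 (d i x) = 0.
Proof. by apply/exact_d; exists x. Qed.

(** [Hom (A / J, E i)], as the submodule of the elements killed by [J]. *)
Definition killed (J : set A) i (x : E i) : Prop := forall a, J a -> a *: x = 0.
Arguments killed J {i} x.

Definition bdry (J : set A) i : E i -> Prop :=
  if i is j.+1 return E i -> Prop then fun x => exists2 y, killed J y & d j y = x
  else fun x => x = 0.
Arguments bdry J {i} x.

Definition cocycle (J : set A) i (x : E i) : Prop := killed J x /\ d i x = 0.
Arguments cocycle J {i} x.

(** The vanishing of [Ext^i (A / J, A)]. *)
Definition ext_zero (J : set A) i : Prop := forall x : E i, cocycle J x -> bdry J x.

Lemma killedP (J : set A) i c (x y : E i) :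
  killed J x -> killed J y -> killed J (c *: x + y).
Proof.
by move=> Jx Jy a Ja; rewrite scalerDr scalerA mulrC -scalerA Jx // Jy // scaler0 addr0.
Qed.

Lemma killed0 (J : set A) i : killed J (0 : E i).
Proof. by move=> a _; rewrite scaler0. Qed.

Lemma killedS (J L : set A) i (x : E i) : J `<=` L -> killed L x -> killed J x.
Proof. by move=> JL Lx a /JL/Lx. Qed.

Lemma killed_d (J : set A) i (x : E i) : killed J x -> killed J (d i x).
Proof. by move=> Jx a Ja; rewrite -linearZ Jx // linear0. Qed.

Lemma cocycleP (J : set A) i c (x y : E i) :
  cocycle J x -> cocycle J y -> cocycle J (c *: x + y).
Proof.
move=> [Jx dx] [Jy dy]; split; first exact: killedP.
by rewrite linearP dx dy scaler0 addr0.
Qed.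

Lemma bdryP (J : set A) i c (x y : E i) : bdry J x -> bdry J y -> bdry J (c *: x + y).
Proof.
case: i x y => [|i] x y /=; first by move=> -> ->; rewrite scaler0 addr0.
move=> [u Ju <-] [v Jv <-]; exists (c *: u + v); first exact: killedP.
by rewrite linearP.
Qed.

Lemma bdry0 (J : set A) i : bdry J (0 : E i).
Proof. by case: i => //= i; exists 0; [apply: killed0 | rewrite linear0]. Qed.

Lemma bdryS (J L : set A) i (x : E i) : J `<=` L -> bdry L x -> bdry J x.
Proof. by case: i x => //= i x JL [y Ly <-]; exists y => //; apply: killedS JL Ly. Qed.

Lemma bdry_cocycle (J : set A) i (x : E i) : bdry J x -> cocycle J x.
Proof.
case: i x => [|i] x /=; first by move=> ->; split; [apply: killed0 | rewrite linear0].
by move=> [y Jy <-]; split; [apply: killed_d | apply: differential_square].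
Qed.

Lemma ext_zero_free i : ext_zero (zero_ideal A) i.+1.
Proof.
move=> x [_ /exact_d[y <-]]; exists y => // a ->.
by rewrite scale0r.
Qed.

(** ** The sequence [0 -> A / (J : a) -> A / J -> A / (J + (a)) -> 0] *)

Lemma killed_adjoin J a i (x : E i) :
  killed (ideal_adjoin J a) x <-> killed J x /\ a *: x = 0.
Proof.
split=> [Jx|[Jx ax] b [c Jb]].
  split=> [b Jb|]; first by apply: Jx; apply: ideal_adjoinl.
  by apply: Jx; apply: ideal_adjoinr.
by rewrite -(subrK (c * a) b) scalerDl Jx // -scalerA ax scaler0 addr0.
Qed.

Lemma killed_colon J a i (x : E i) : killed J x -> killed (colon J a) (a *: x).
Proof. by move=> Jx b Jb; rewrite scalerA Jx. Qed.

(** Restriction along the injection of [A / (J : a)] is onto, because [E i] is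
    injective. *)
Lemma killed_colon_lift J a i (w : E i) :
  killed (colon J a) w -> exists2 v, killed J v & a *: v = w.
Proof.
move=> Jw; pose G b x := exists2 c, J (b - c * a) & x = c *: w.
have [||x [c Jc ->]|v vP] := @injective_relation A (E i) G _ _ (@injE i).
- by exists 0; [rewrite mul0r subr0; apply: ideal0 | rewrite scale0r].
- move=> c b b' x x' [r Jr ->] [r' Jr' ->]; exists (c * r + r').
    rewrite mulrDl opprD addrACA -mulrA -mulrBr; apply: idealD => //.
    exact: idealMl.
  by rewrite scalerDl scalerA.
- by apply: Jw; have := idealN Jc; rewrite /= sub0r opprK.
exists v => [b Jb|].
  by rewrite -(vP b 0) //; exists 0; [rewrite mul0r subr0 | rewrite scale0r].
rewrite -(vP a w) //; exists 1; last by rewrite scale1r.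
by rewrite mul1r subrr; apply: ideal0.
Qed.

Lemma bdry_colon J a i (x : E i) : bdry J x -> bdry (colon J a) (a *: x).
Proof.
case: i x => [|i] x /=; first by move=> ->; rewrite scaler0.
by move=> [y Jy <-]; exists (a *: y); [apply: killed_colon | rewrite linearZ].
Qed.

Lemma bdry_colon_lift J a i (w : E i) :
  bdry (colon J a) w -> exists2 v, bdry J v & a *: v = w.
Proof.
case: i w => [|i] w /=; first by move=> ->; exists 0 => //; rewrite scaler0.
move=> [u /killed_colon_lift[v Jv <-] <-]; exists (d i v); first by exists v.
by rewrite linearZ.
Qed.

(** The next lemmas are portions of the long exact sequence of Ext. *)
Lemma ext_zero_adjoin J a i :
  ext_zero J i.+1 -> ext_zero (colon J a) i -> ext_zero (ideal_adjoin J a) i.+1.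
Proof.
move=> exJ exJa z [/killed_adjoin[Jz az] dz]; have [v Jv vz] := exJ z (conj Jz dz).
have [|w Jw wE] := @bdry_colon_lift J a i (a *: v).
  by apply: exJa; split; [apply: killed_colon | rewrite linearZ vz].
have [Jw' dw] := bdry_cocycle Jw.
exists (v - w); last by rewrite linearB dw subr0.
by apply/killed_adjoin; split; [rewrite addrC -scaleN1r; apply: killedP | rewrite scalerBr wE subrr].
Qed.

Lemma cocycle_colon_lift J a i : ext_zero (ideal_adjoin J a) i.+1 ->
  forall w : E i, cocycle (colon J a) w -> exists2 v, cocycle J v & a *: v = w.
Proof.
move=> ex w [/killed_colon_lift[v Jv <-]]; rewrite linearZ => adv.
have [|u /killed_adjoin[Ju au] uE] := ex (d i v).
  split; last exact: differential_square.
  by apply/killed_adjoin; split=> //; apply: killed_d.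
exists (v - u); last by rewrite scalerBr au subr0.
by split; [rewrite addrC -scaleN1r; apply: killedP | rewrite linearB uE subrr].
Qed.

Lemma ext_zero_colon J a i :
  ext_zero J i -> ext_zero (ideal_adjoin J a) i.+1 -> ext_zero (colon J a) i.
Proof.
move=> exJ /cocycle_colon_lift lift w /lift[v Jv <-].
by apply: bdry_colon; apply: exJ.
Qed.

Lemma ext_zero_extension J a i :
  ext_zero (ideal_adjoin J a) i -> ext_zero (colon J a) i -> ext_zero J i.
Proof.
move=> exJa exJ z [Jz dz].
have [|v Jv vE] := @bdry_colon_lift J a i (a *: z).
  by apply: exJ; split; [apply: killed_colon | rewrite linearZ dz /= scaler0].
rewrite -(subrK v z) -[z - v]scale1r; apply: bdryP => //.
apply: (@bdryS J (ideal_adjoin J a)); first by move=> ?; apply: ideal_adjoinl.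
have [Jv' dv] := bdry_cocycle Jv.
apply: exJa; split; last by rewrite linearB dz dv subr0.
by apply/killed_adjoin; split; [rewrite addrC -scaleN1r; apply: killedP | rewrite scalerBr vE subrr].
Qed.

Hypothesis noethA : noetherian A.

(** The submodules [L] of [Ext^i (A / J, A)] are finitely generated. *)
Definition ext_noetherian (J : set A) i : Prop := forall L : E i -> Prop,
  (forall c x y, L x -> L y -> L (c *: x + y)) ->
  (forall x, bdry J x -> L x) -> (forall x, L x -> cocycle J x) ->
  exists2 s, (forall x, x \in s -> L x) & (forall x, L x -> span_mod (bdry J) s x).

Lemma ext_noetherian0 (J : set A) : ext_noetherian J 0.
Proof.
move=> L LP LB LZ.
have L0 : L 0 by apply: LB; apply: bdry0.
pose S : set A := [set a | L (e a)].
have S0 : S 0 by rewrite /S /= linear0.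
have SD (x y : A) : S x -> S y -> S (x + y).
  by rewrite /S /= => Lx Ly; rewrite linearD -[e x]scale1r; apply: LP.
have SM (a x : A) : S x -> S (a * x).
  rewrite /S /= => Lx; have -> : e (a * x) = a *: e x + 0 by rewrite -linearZ addr0.
  exact: LP.
have [s sE] := noetherian_adjoin noethA (Ideal S0 SD SM).
have LsE a : L (e a) <-> adjoin (zero_ideal A) s a by rewrite -sE.
exists [seq e a | a <- s] => [_ /mapP[a as_ ->]|x Lx].
  by apply/LsE; apply: adjoinr.
have [_ /exact_e[a aE]] := LZ x Lx; rewrite -aE in Lx *.
by move/LsE/span_mod_adjoin: Lx; apply: span_mod_linear => _ ->; rewrite linear0.
Qed.

(** [Ext^(i+1) (A / (J + (a)), A)] lies between [Ext^i (A / (J : a), A)] and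
    [Ext^(i+1) (A / J, A)] in the long exact sequence. *)
Lemma ext_noetherian_adjoin J a i : ext_noetherian (colon J a) i ->
  ext_noetherian J i.+1 -> ext_noetherian (ideal_adjoin J a) i.+1.
Proof.
move=> nJa nJ L LP LB LZ.
have JJa (b : A) : J b -> ideal_adjoin J a b by apply: ideal_adjoinl.
have L0 : L 0 by apply: LB; apply: bdry0.
have [|||s sL Ls] := nJ (fun x => exists2 l, L l & bdry J (x - l)).
- move=> c x y [l Ll xl] [m Lm ym]; exists (c *: l + m); first exact: LP.
  by rewrite opprD addrACA -scalerBr; apply: bdryP.
- by move=> x Bx; exists 0 => //; rewrite subr0.
- move=> x [l /LZ[Jl dl] /bdry_cocycle[Jxl dxl]]; rewrite -(subrK l x) -[x - l]scale1r.
  by apply: cocycleP; split=> //; apply: killedS Jl.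
have [w wL sw] := span_mod_replace (@bdryP J i.+1) sL.
have Lw x : L x -> span_mod (fun y => bdry J y /\ L y) w x.
  move=> Lx; apply: span_mod_restrict => //; apply: sw; apply: Ls.
  by exists x => //; rewrite subrr; apply: bdry0.
(* What is left are the coboundaries [d v] in [L] with [v] killed by [J]; they
   are controlled by the classes of the [a *: v]. *)
have [|||s2 s2L s2P] := nJa (fun x => exists v, [/\ killed J v, L (d i v) & a *: v = x]).
- move=> c _ _ [v [Jv Lv <-]] [v' [Jv' Lv' <-]]; exists (c *: v + v').
  split; [exact: killedP | by rewrite linearP; apply: LP |].
  by rewrite scalerDr !scalerA mulrC.
- move=> x /bdry_colon_lift[v /bdry_cocycle[Jv dv] vx]; exists v; split=> //.
  by rewrite dv.
- move=> _ [v [Jv /LZ[Jdv _] <-]]; split; first exact: killed_colon.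
  by have [_] := (killed_adjoin J a (d i v)).1 Jdv; rewrite linearZ.
have [vs vsL s2E] : exists2 vs, (forall v, v \in vs -> killed J v /\ L (d i v)) &
    s2 = [seq a *: v | v <- vs].
  elim: (s2) s2L => [|x r IHr] rP; first by exists [::].
  have [|vs vsL ->] := IHr; first by move=> y yr; apply: rP; rewrite in_cons yr orbT.
  have [v [Jv Lv <-]] := rP x (mem_head _ _); exists (v :: vs) => // u.
  by rewrite in_cons => /orP[/eqP ->|/vsL].
exists (w ++ [seq d i v | v <- vs]).
  by move=> x; rewrite mem_cat => /orP[/wL //|/mapP[v /vsL[_ Lv] ->]].
move=> x /Lw; apply: span_mod_cat => _ [[v Jv <-] Lv].
have: span_mod (bdry (colon J a)) s2 (a *: v) by apply: s2P; exists v.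
rewrite s2E; elim: vs vsL v Jv {Lv s2E} => [|u vs IHvs] vsL v Jv /=.
  move=> /bdry_colon_lift[c /bdry_cocycle[Jc dc] cv]; exists (v - c).
    apply/killed_adjoin; split; last by rewrite scalerBr cv subrr.
    by rewrite addrC -scaleN1r; apply: killedP.
  by rewrite linearB dc subr0.
have [Ju _] := vsL u (mem_head _ _).
move=> [c]; rewrite scalerA mulrC -scalerA -scalerBr => vc; exists c.
rewrite -linearZ -linearB; apply: IHvs => //.
  by move=> z zs; apply: vsL; rewrite in_cons zs orbT.
by rewrite addrC -scaleNr; apply: killedP.
Qed.

(** Add the generators of [J] one at a time to the zero ideal, for which
    [Ext^(i+1)] vanishes. *)
Lemma ext_noetherian_all J i : ext_noetherian J i.
Proof.
elim: i J => [|i IHi] J; first exact: ext_noetherian0.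
have [s ->] := noetherian_adjoin noethA J.
have: ext_noetherian (zero_ideal A) i.+1.
  move=> L LP LB LZ; exists [::] => // x /LZ; exact: ext_zero_free.
elim: s (zero_ideal A) => //= a s IHs L nL; apply: IHs.
exact: ext_noetherian_adjoin.
Qed.

(** Multiplication by [a] maps [Ext^i (A / J, A)] onto itself, as the next term of
    the long exact sequence vanishes, and Nakayama's lemma applies. *)
Lemma ext_zero_nakayama J a i : (forall b, exists c, c * (1 - a * b) = 1) ->
  colon J a `<=` J -> ext_zero (ideal_adjoin J a) i.+1 -> ext_zero J i.
Proof.
move=> unit_a JaJ ex.
have [|||s sZ Zs] := @ext_noetherian_all J i (@cocycle J i).
- exact: cocycleP.
- exact: bdry_cocycle.
- by [].
apply: (nakayama (@bdryP J i) unit_a sZ Zs) => x [Jx dx].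
have [|y Zy <-] := cocycle_colon_lift ex (w := x).
  by split=> //; apply: killedS Jx.
by exists y => //; rewrite subrr; apply: bdry0.
Qed.

(** ** Ext of a quotient by a canonical ideal *)

(** Under these hypotheses [A / J] has the canonical module [J'], the annihilator
    of [J], and [psi] identifies the ideal [K / J] of [A / J] with it. *)
Section Linkage.
Variables (J J' K : ideal A) (psi : A -> A).
Hypothesis JK : J `<=` K.
Hypothesis psiP : forall c k l, K k -> K l -> psi (c * k + l) = c * psi k + psi l.
Hypothesis psi_ker : forall k, K k -> psi k = 0 <-> J k.
Hypothesis psi_im : forall u, J' u <-> exists2 k, K k & psi k = u.
Hypothesis annJ : forall a, (forall b, J b -> b * a = 0) -> J' a.
Hypothesis annJ' : forall a, (forall b, J' b -> b * a = 0) -> J a.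
Hypothesis annK : forall a, (forall b, K b -> b * a = 0) -> a = 0.
Hypothesis exJ : forall i, ext_zero J i.+1.
Hypothesis exJ' : forall i, ext_zero J' i.+1.

Lemma psi0 : psi 0 = 0.
Proof. by apply/psi_ker; apply: ideal0. Qed.

Lemma psiM a k : K k -> psi (a * k) = a * psi k.
Proof. by move=> Kk; rewrite -[a * k]addr0 psiP ?psi0 ?addr0 //; apply: ideal0. Qed.

(** The map [psi k |-> k *: y] on [J'] extends to [A], that is, it is
    multiplication by some [w]; [w] can be changed into a cocycle because
    [Ext (A / J', A)] vanishes. *)
Lemma linkage_dual i (y : E i) : killed J y -> killed K (d i y) ->
  exists2 w, d i w = 0 & forall k, K k -> k *: y = psi k *: w.
Proof.
move=> Jy Kdy; pose G a x := exists k, [/\ K k, psi k = a & k *: y = x].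
have [||x [k [Kk k0 <-]]|w wP] := @injective_relation A (E i) G _ _ (@injE i).
- by exists 0; split; [apply: ideal0 | apply: psi0 | rewrite scale0r].
- move=> c _ _ _ _ [k [Kk <- <-]] [l [Kl <- <-]]; exists (c * k + l).
  by split; [apply: idealD => //; apply: idealMl | apply: psiP | rewrite scalerDl scalerA].
- by apply: Jy; apply/psi_ker.
have wE k : K k -> k *: y = psi k *: w by move=> Kk; apply: wP; exists k.
have [|w' J'w' dw'] := exJ' (x := d i w).
  split; last exact: differential_square.
  move=> _ /psi_im[k Kk <-]; rewrite -linearZ /= -wE //.
  by rewrite linearZ /= Kdy.
exists (w - w'); first by rewrite linearB dw' subrr.
by move=> k Kk; rewrite scalerBr (J'w' (psi k)) ?subr0 ?wE //; apply/psi_im; exists k.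
Qed.

(** An extension to [A / J] of the map that [psi] and [v] define on [K / J]. *)
Lemma linkage_extend i (v : E i) :
  exists2 y, killed J y & forall k, K k -> k *: y = psi k *: v.
Proof.
pose G a x := K a /\ x = psi a *: v.
have [||x [_ ->]|y yP] := @injective_relation A (E i) G _ _ (@injE i).
- by split; [apply: ideal0 | rewrite psi0 scale0r].
- move=> c k l _ _ [Kk ->] [Kl ->]; split; last by rewrite psiP // scalerDl scalerA.
  by apply: idealD => //; apply: idealMl.
- by rewrite psi0 scale0r.
exists y => [a Ja|k Kk]; last by rewrite -(yP k (psi k *: v)).
rewrite -(yP a (psi a *: v)); last by split=> //; apply: JK.
by rewrite (psi_ker (JK Ja)).2 // scale0r.
Qed.

Lemma linkage_ext0 (x : E 0%N) : cocycle K x -> x = 0.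
Proof.
move=> [Kx /exact_e[a aE]]; rewrite -aE; suff -> : a = 0 by rewrite linear0.
apply: annK => b Kb; apply: e_inj; rewrite linear0.
have -> : e (b * a) = b *: e a by rewrite -linearZ.
by rewrite aE Kx.
Qed.

(** A cocycle killed by [K] is the coboundary of some [y] killed by [J]; the map
    that [y] defines on [K / J] is a coboundary, as [Ext (J', A)] vanishes, and
    extends to [A / J]. *)
Lemma linkage_ext_ge2 i : ext_zero K i.+2.
Proof.
move=> x [Kx dx]; have [|y Jy yx] := exJ (x := x).
  by split=> //; apply: killedS Kx.
have [|w /exact_d[v <-] wy] := linkage_dual Jy; first by rewrite yx.
have [u Ju uv] := linkage_extend v.
exists (y - d i u); last by rewrite linearB differential_square subr0.
by move=> k Kk; rewrite scalerBr wy // -!linearZ /= uv // subrr.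
Qed.

(** [Ext^1 (A / K, A)] is the quotient of [Hom (K / J, A) = Hom (J', A) = A / J] by
    [Hom (A / J, A) = J'], embedded as [K / J]. The generator [z] is the image of
    the class of 1, which corresponds to [psi] itself. *)
Lemma linkage_ext1 : exists z : E 1%N, [/\ cocycle K z,
  forall s, bdry K (s *: z) -> K s &
  forall x : E 1%N, cocycle K x -> exists s, bdry K (x - s *: z)].
Proof.
have eZ s : e s = s *: e (1 : A).
  by rewrite -linearZ; congr (e _); rewrite [RHS]mulr1.
have [y Jy yE] := linkage_extend (e (1 : A)).
have de : d 0%N (e (1 : A)) = 0 :> E 1%N by apply/exact_e; exists 1.
exists (d 0%N y); split.
- split; last exact: differential_square.
  by move=> k Kk; rewrite -linearZ /= yE // linearZ de /= scaler0.
- move=> s [y' Ky' /esym/eqP]; rewrite -linearZ -subr_eq0 -linearB => /eqP/exact_e[s' sE].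
  have key a : a * s' = 0 <-> a *: (s *: y - y') = 0.
    rewrite -sE; have -> : a *: e s' = e (a * s') by rewrite -linearZ.
    by split=> [->|as0]; [rewrite linear0 | apply: e_inj; rewrite linear0].
  have /psi_im[k' Kk' k'E] : J' s'.
    apply: annJ => a Ja; apply/key; rewrite scalerBr scalerA mulrC -scalerA Jy //.
    by rewrite scaler0 Ky' ?subr0 //; apply: JK.
  rewrite -(subrK k' s); apply: idealD => //; apply: JK; apply: annJ'.
  move=> _ /psi_im[k Kk <-]; have ks : k * s' = psi k * s.
    apply: e_inj; have -> : e (k * s') = k *: (s *: y - y') by rewrite -sE -linearZ.
    by rewrite scalerBr Ky' // subr0 scalerA [k * s]mulrC -scalerA yE // scalerA -eZ mulrC.
  by rewrite mulrBr -ks -k'E -psiM // [k * k']mulrC psiM // mulrC subrr.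
- move=> x [Kx dx]; have [|u Ju ux] := exJ (x := x).
    by split=> //; apply: killedS Kx.
  have [|w /exact_e[s <-] wE] := linkage_dual Ju; first by rewrite ux.
  exists s, (u - s *: y); last by rewrite linearB linearZ ux.
  move=> k Kk; rewrite scalerBr wE // scalerA mulrC -scalerA yE // eZ.
  by rewrite !scalerA mulrC subrr.
Qed.

End Linkage.

(** * Vanishing of Ext over a local ring of finite injective dimension *)

Variable N : nat.
Hypothesis E_bound : forall i, (N < i)%N -> forall x : E i, x = 0.
Variable m : ideal A.
Hypothesis m_proper : ~ m 1.
Hypothesis m_unit : forall x, ~ m x -> exists y, y * x = 1.
(* In the application T is the maximal ideal of R, inside the truncated Rees
   ring. *)
Variable T : set A.
Hypothesis T0 : T 0.
Hypothesis TD : forall x y, T x -> T y -> T (x + y).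
Hypothesis TM : forall x y, T x -> T y -> T (x * y).
Hypothesis Tm : T `<=` m.
Hypothesis T_prime : forall P, prime_ideal P -> T `<=` P -> m `<=` P.

(** When the sequence cannot be prolonged, [T] kills a nonzero element of the
    quotient, and so does [m]: the residue field embeds in the quotient. *)
Lemma maximal_regular_sequence J : ~ J 1 ->
  exists s, regular_in T J s /\ exists u, (colon (adjoin J s) u : set A) = m.
Proof.
elim/(noetherian_ind noethA): J => J IHJ J1.
have [Tzd|] := pselect (forall x, T x -> exists2 u, ~ J u & J (x * u)).
  have [u maxu Tu] := zero_divisors_killed noethA T0 TD TM Tzd.
  have uprime := max_colon_prime maxu.
  exists [::]; split=> //; exists u; apply/seteqP; split; last exact: T_prime.
  exact: (proper_sub_max m_unit uprime.1).
move=> /existsNP[x /not_implyP[Tx nzd]].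
have JxJ : colon J x `<=` J.
  move=> u /= Jux; apply: contrapT => Ju; apply: nzd; exists u => //.
  by rewrite mulrC.
have [| | |s [regs [u uE]]] := IHJ (ideal_adjoin J x).
- by move=> a; apply: ideal_adjoinl.
- move=> /(_ _ (ideal_adjoinr J x)) Jx; apply: J1; apply: JxJ.
  by rewrite /= mul1r.
- move=> Jx1; apply: m_proper; apply: (ideal_adjoin_min _ _ Jx1); last exact: Tm.
  exact: (proper_sub_max m_unit).
by exists (x :: s); split=> //; exists u.
Qed.

Lemma ext_zero_regular J s k : regular_in T J s ->
  (forall i, (k < i)%N -> ext_zero J i) ->
  forall i, (k + size s < i)%N -> ext_zero (adjoin J s) i.
Proof.
elim: s J k => [|x s IHs] J k /=; first by rewrite addn0.
move=> [[_ JxJ] regs] exJ i; rewrite addnS -addSn; apply: IHs => // -[//|j] kj.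
apply: ext_zero_adjoin; first by apply: exJ; apply: ltnW.
suff -> : colon J x = J by apply: exJ.
by apply: ideal_eqP; apply/seteqP; split=> // a Ja /=; rewrite mulrC; apply: idealMl.
Qed.

(** Let [J] be maximal among the counterexamples. It is neither [A] nor [m], so
    some [x] in [m] lies outside [J]. If [J : x] is larger than [J], then [A / J]
    is an extension of two modules whose [Ext^n] vanish; otherwise [x] is regular
    modulo [J] and Nakayama's lemma applies. *)
Lemma ext_zero_residue n :
  (forall J, ext_zero J n.+1) -> ext_zero m n -> forall J, ext_zero J n.
Proof.
move=> exn exm; apply: (noetherian_ind noethA) => J IHJ.
have [J1|J1] := pselect (J 1).
  by move=> x [Jx _]; rewrite -[x]scale1r Jx //; apply: bdry0.
have [mJ|] := pselect (m `<=` J).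
  suff -> : (J : set A) = m by [].
  by apply/seteqP; split=> //; apply: (proper_sub_max m_unit).
move=> /existsNP[x /not_implyP[mx Jx]].
have [JxJ|JxJ] := pselect (colon J x `<=` J).
  by apply: (ext_zero_nakayama (max_unit_1B m_proper m_unit mx) JxJ); apply: exn.
apply: (@ext_zero_extension J x); apply: IHJ => //.
- by move=> a; apply: ideal_adjoinl.
- by move/(_ _ (ideal_adjoinr J x)).
- by move=> a Ja /=; rewrite mulrC; apply: idealMl.
Qed.

(** The injective dimension is at most the depth: with [k] the residue field and
    [s] a maximal regular sequence, [Ext^n (A / (s), A)] maps onto
    [Ext^n (k, A)] when [n] is the injective dimension. *)
Lemma injective_dimension_depth : exists s, regular_in T (zero_ideal A) s /\
  forall i J, (size s < i)%N -> ext_zero J i.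
Proof.
have [|s [regs [u uE]]] := @maximal_regular_sequence (zero_ideal A).
  by move=> A0; apply: m_proper; rewrite A0; apply: ideal0.
exists s; split=> // i J si; move: J.
suff bound k : forall i, (N < i + k)%N -> (size s < i)%N -> forall J, ext_zero J i.
  by apply: (bound N.+1) => //; rewrite addnS ltnS leq_addl.
elim: k => [|k IHk] {si}i; first rewrite addn0.
  by move=> Ni _ J x _; rewrite (E_bound Ni x); apply: bdry0.
rewrite addnS -addSn => Nik si; apply: ext_zero_residue; first by apply: IHk => //; apply: ltnW.
rewrite -uE; apply: ext_zero_colon; last by apply: IHk => //; apply: ltnW.
apply: (@ext_zero_regular (zero_ideal A) s 0) => // -[//|j] _.
exact: ext_zero_free.
Qed.

(** Each regular element lowers by one the degree from which Ext vanishes. *)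
Lemma ext_zero_descend J s k : regular_in T J s ->
  (forall i, (k + size s < i)%N -> ext_zero (adjoin J s) i) ->
  forall i, (k < i)%N -> ext_zero J i.
Proof.
elim: s J k => [|x s IHs] J k /=; first by rewrite addn0.
move=> [[Tx JxJ] regs] exJ i ki.
apply: (ext_zero_nakayama (max_unit_1B m_proper m_unit (Tm Tx)) JxJ).
by apply: (IHs _ k.+1) => // j; rewrite addSn -addnS; apply: exJ.
Qed.

(** [J] is the kernel of a [T]-linear projector, so that [A / J] is a direct
    summand of [A] as far as multiplication by [T] is concerned: the maximal
    regular sequence is regular modulo [J] too. *)
Lemma ext_zero_summand J (tau : A -> A) :
  (forall x y, tau (x - y) = tau x - tau y) ->
  (forall r x, T r -> tau (r * x) = r * tau x) ->
  (forall x, tau (tau x) = tau x) -> (forall x, J x <-> tau x = 0) ->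
  forall i, ext_zero J i.+1.
Proof.
move=> tauB tauT tauK tauJ i; have [s [regs exs]] := injective_dimension_depth.
have tau_reg (K L : ideal A) : regular_in T L s -> (forall u, L u -> L (tau u)) ->
    (forall u, K u <-> L (tau u)) -> regular_in T K s.
  elim: (s) K L => //= x r IHr K L [[Tx LxL] regr] Ltau KL; split.
    split=> // u /= /KL; rewrite mulrC tauT // mulrC => /LxL; exact: (KL u).2.
  apply: IHr regr _ _ => [u [c Lu]|u].
    by exists (tau c); rewrite mulrC -tauT // -tauB mulrC; apply: Ltau.
  split=> [[c /KL]|[c Lc]]; first by rewrite tauB [c * x]mulrC tauT // mulrC; exists (tau c).
  by exists c; apply/KL; have := Ltau _ Lc; rewrite !tauB tauK.
have regJ : regular_in T J s.
  apply: tau_reg regs _ _ => [u -> /=|u]; last exact: tauJ.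
  by have := tauB 0 0; rewrite !subrr.
apply: (ext_zero_descend regJ (k := 0)) => // j sj; exact: exs.
Qed.

End Cohomology.

(** * Injective modules over a quotient ring *)

Section Restriction.
Variables (A C : comPzRingType) (pi : {rmorphism A -> C}) (M : lmodType C).

Definition restriction (_ : {rmorphism A -> C}) : Type := M.

HB.instance Definition _ := GRing.Zmodule.on (restriction pi).

Definition restriction_scale (a : A) (x : restriction pi) : restriction pi :=
  pi a *: (x : M).

Fact restriction_scaleA a b x :
  restriction_scale a (restriction_scale b x) = restriction_scale (a * b) x.
Proof. by rewrite /restriction_scale scalerA rmorphM. Qed.
Fact restriction_scale1 : left_id 1 restriction_scale.
Proof. by move=> x; rewrite /restriction_scale rmorph1 scale1r. Qed.
Fact restriction_scaleDr : right_distributive restriction_scale +%R.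
Proof. by move=> a x y; rewrite /restriction_scale scalerDr. Qed.
Fact restriction_scaleDl x : {morph restriction_scale^~ x : a b / a + b}.
Proof. by move=> a b; rewrite /restriction_scale rmorphD scalerDl. Qed.

HB.instance Definition _ := GRing.Zmodule_isLmodule.Build A (restriction pi)
  restriction_scaleA restriction_scale1 restriction_scaleDr restriction_scaleDl.

End Restriction.

Section Torsion.
Variables (A C : comPzRingType) (pi : {rmorphism A -> C}).
Variables (sigma : C -> A) (sigmaK : cancel sigma pi) (E : lmodType A).

(** [Hom_A (C, E)], as the submodule of [E] killed by the kernel of [pi]. *)
Definition torsion_mem : {pred E} := fun x => `[< forall a, pi a = 0 -> a *: x = 0 >].

Fact torsion_submod : submod_closed torsion_mem.
Proof.
split=> [|c x y]; rewrite !unfold_in; first by apply/asboolP=> a _; rewrite scaler0.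
move=> /asboolP xP /asboolP yP; apply/asboolP => a a0.
by rewrite scalerDr scalerA mulrC -scalerA xP // yP // scaler0 addr0.
Qed.

HB.instance Definition _ := GRing.isSubmodClosed.Build A E torsion_mem torsion_submod.

Record torsion := Torsion { torsion_val :> E; torsionP : torsion_val \in torsion_mem }.

HB.instance Definition _ := [isSub for torsion_val].
HB.instance Definition _ := [Choice of torsion by <:].
HB.instance Definition _ := [SubChoice_isSubZmodule of torsion by <:].

Lemma torsion_kill (x : torsion) a : pi a = 0 -> a *: (x : E) = 0.
Proof. by move=> a0; have /asboolP := torsionP x; apply. Qed.

Lemma torsion_scale_lift (x : torsion) a : sigma (pi a) *: (x : E) = a *: (x : E).
Proof.
apply/eqP; rewrite -subr_eq0 -scalerBl; apply/eqP; apply: torsion_kill.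
by rewrite rmorphB sigmaK subrr.
Qed.

(** The structure of module over [C] needs the section [sigma] of [pi], which is
    therefore a parameter of the type. *)
Definition coinduced (_ : cancel sigma pi) : Type := torsion.

HB.instance Definition _ := GRing.Zmodule.on (coinduced sigmaK).

Definition coinduced_scale (c : C) (x : coinduced sigmaK) : coinduced sigmaK :=
  Torsion (rpredZ (sigma c) (torsionP x)).

Fact coinduced_scaleA a b x :
  coinduced_scale a (coinduced_scale b x) = coinduced_scale (a * b) x.
Proof.
apply/val_inj; rewrite /= scalerA -{2}(sigmaK a) -{2}(sigmaK b) -rmorphM.
by rewrite torsion_scale_lift.
Qed.
Fact coinduced_scale1 : left_id 1 coinduced_scale.
Proof.
by move=> x; apply/val_inj; rewrite /= -(rmorph1 pi) torsion_scale_lift scale1r.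
Qed.
Fact coinduced_scaleDr : right_distributive coinduced_scale +%R.
Proof. by move=> a x y; apply/val_inj; rewrite /= scalerDr. Qed.
Fact coinduced_scaleDl x : {morph coinduced_scale^~ x : a b / a + b}.
Proof.
move=> a b; apply/val_inj; rewrite /= -{1}(sigmaK a) -{1}(sigmaK b) -rmorphD.
by rewrite torsion_scale_lift scalerDl.
Qed.

HB.instance Definition _ := GRing.Zmodule_isLmodule.Build C (coinduced sigmaK)
  coinduced_scaleA coinduced_scale1 coinduced_scaleDr coinduced_scaleDl.

Definition coinduced_val (x : coinduced sigmaK) : E := torsion_val x.

Lemma coinduced_val_inj : injective coinduced_val.
Proof. exact: val_inj. Qed.

Lemma coinduced_valP c (x y : coinduced sigmaK) :
  coinduced_val (c *: x + y) = sigma c *: coinduced_val x + coinduced_val y.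
Proof. by []. Qed.

Lemma coinduced_kill (x : coinduced sigmaK) a : pi a = 0 -> a *: coinduced_val x = 0.
Proof. exact: torsion_kill. Qed.

Lemma coinduced_lift (x : coinduced sigmaK) a :
  sigma (pi a) *: coinduced_val x = a *: coinduced_val x.
Proof. exact: torsion_scale_lift. Qed.

Lemma coinduced_build x : (forall a, pi a = 0 -> a *: x = 0) ->
  exists y, coinduced_val y = x.
Proof. by move=> /asboolP xP; exists (Torsion xP). Qed.

End Torsion.

Section CoinducedMap.
Variables (A C : comPzRingType) (pi : {rmorphism A -> C}).
Variables (sigma : C -> A) (sigmaK : cancel sigma pi).

Lemma coinduced_linear (M : lmodType C) (E : lmodType A) (f : M -> coinduced E sigmaK) :
  (forall c x y, coinduced_val (f (c *: x + y)) =
     sigma c *: coinduced_val (f x) + coinduced_val (f y)) -> linear f.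
Proof. by move=> fP c x y; apply: coinduced_val_inj; rewrite fP. Qed.

Lemma coinduced_injective (E : lmodType A) :
  injective_module E -> injective_module (coinduced E sigmaK : lmodType C).
Proof.
move=> injE M N i f i_inj.
have i_lin : linear (i : restriction M pi -> restriction N pi).
  by move=> a x y; exact: (linearP i (pi a) x y).
have f_lin : linear (fun x : restriction M pi => coinduced_val (f x)).
  move=> a x y; rewrite [f _](linearP f (pi a) x y) coinduced_valP.
  by rewrite coinduced_lift.
pose iL := GRing.isLinear.Build A _ _ _ _ i_lin.
pose i' : {linear restriction M pi -> restriction N pi} := HB.pack (i : restriction M pi -> restriction N pi) iL.
pose fL := GRing.isLinear.Build A _ _ _ _ f_lin.
pose f' : {linear restriction M pi -> E} := HB.pack (fun x : restriction M pi => coinduced_val (f x)) fL.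
have [//|g gE] := injE _ _ i' f'.
have gC (x : N) : g (x : restriction N pi) \in torsion_mem pi (E := E).
  apply/asboolP => a a0; rewrite -linearZ -[RHS](linear0 g); congr (g _).
  by rewrite [LHS](_ : _ = pi a *: x) // a0 scale0r.
pose h x : coinduced E sigmaK := Torsion (gC x).
have h_lin : linear h.
  apply: coinduced_linear => c x y; rewrite /coinduced_val /=.
  by rewrite -linearP; congr (g _); rewrite -{1}(sigmaK c).
pose hL := GRing.isLinear.Build C _ _ _ _ h_lin.
pose h' : {linear N -> coinduced E sigmaK} := HB.pack h hL.
by exists h' => x; apply: coinduced_val_inj; exact: (gE x).
Qed.

Variables (E F : lmodType A) (f : {linear E -> F}).

Fact coinduced_map_proof (x : coinduced E sigmaK) :
  f (coinduced_val x) \in torsion_mem pi (E := F).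
Proof.
by apply/asboolP => a a0; rewrite -linearZ /= coinduced_kill ?linear0.
Qed.

Definition coinduced_map (x : coinduced E sigmaK) : coinduced F sigmaK :=
  Torsion (coinduced_map_proof x).

Fact coinduced_map_linear : linear coinduced_map.
Proof. by apply: coinduced_linear => c x y; rewrite /coinduced_val /= -linearP. Qed.

HB.instance Definition _ := GRing.isLinear.Build C _ _ _ coinduced_map coinduced_map_linear.

Lemma coinduced_mapE x : coinduced_val (coinduced_map x) = f (coinduced_val x).
Proof. by []. Qed.

End CoinducedMap.

Arguments coinduced_map {A C pi sigma} sigmaK {E F} f x.
Arguments coinduced_injective {A C pi sigma} sigmaK {E} _.

Section Kernel.
Variables (C : comPzRingType) (V W : lmodType C) (f : {linear V -> W}).

Definition kernel_mem : {pred V} := fun x => f x == 0.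

Fact kernel_submod : submod_closed kernel_mem.
Proof.
split=> [|c x y]; rewrite !unfold_in; first by rewrite linear0.
by move=> /eqP fx /eqP fy; rewrite linearP fx fy scaler0 addr0.
Qed.

HB.instance Definition _ := GRing.isSubmodClosed.Build C V kernel_mem kernel_submod.

Record kernel := Kernel { kernel_val :> V; kernelP : kernel_val \in kernel_mem }.

HB.instance Definition _ := [isSub for kernel_val].
HB.instance Definition _ := [Choice of kernel by <:].
HB.instance Definition _ := [SubChoice_isSubLmodule of kernel by <:].

Lemma kernel_val0 (x : kernel) : f (kernel_val x) = 0.
Proof. by apply/eqP; case: x. Qed.

(** An extension to [V] is corrected by the projector that the splitting gives. *)
Lemma kernel_injective (g : {linear W -> V}) : cancel g f ->
  injective_module V -> injective_module (kernel : lmodType C).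
Proof.
move=> gK injV M N i h i_inj.
have h_lin : linear (fun x => kernel_val (h x)) by move=> c x y; rewrite linearP.
pose hL := GRing.isLinear.Build C _ _ _ _ h_lin.
pose h' : {linear M -> V} := HB.pack (fun x => kernel_val (h x)) hL.
have [//|k kE] := injV _ _ i h'.
have kP x : k x - g (f (k x)) \in kernel_mem.
  by apply/eqP; rewrite linearB gK subrr.
have k_lin : linear (fun x => Kernel (kP x)).
  move=> c x y; apply/val_inj; rewrite /= !linearP.
  by rewrite addrACA -scalerDr.
pose kL := GRing.isLinear.Build C _ _ _ _ k_lin.
pose k' : {linear N -> kernel} := HB.pack (fun x => Kernel (kP x)) kL.
exists k' => x; apply/val_inj => /=.
by rewrite kE /= kernel_val0 linear0 subr0.
Qed.

End Kernel.

(** * Quotients of finite injective dimension *)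

Section QuotientResolution.
Variables (A C : comPzRingType) (pi : {rmorphism A -> C}).
Variables (sigma : C -> A) (sigmaK : cancel sigma pi).
Variables (E : nat -> lmodType A) (d : forall i, {linear E i -> E i.+1}) (N : nat).
Hypothesis injE : forall i, injective_module (E i).
Hypothesis d_square : forall i (x : E i), d i.+1 (d i x) = 0.
Hypothesis E_bound : forall i, (N < i)%N -> forall x : E i, x = 0.
Variable K : ideal A.
Hypothesis Kpi : forall a, K a <-> pi a = 0.
Hypothesis ext0 : forall x : E 0%N, cocycle d K x -> x = 0.
Variable z : E 1%N.
Hypothesis z_cocycle : cocycle d K z.
Hypothesis z_free : forall s, bdry d K (s *: z) -> K s.
Hypothesis z_gen : forall x : E 1%N, cocycle d K x -> exists s, bdry d K (x - s *: z).
Hypothesis ext_ge2 : forall i, ext_zero d K i.+2.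

Let T i : lmodType C := coinduced (E i) sigmaK.
Let D i : {linear T i -> T i.+1} := coinduced_map sigmaK (d i).

Let valT i (x : T i) : E i := coinduced_val x.

Let T_killed i (x : T i) : killed K (valT x).
Proof. by move=> a /Kpi; apply: coinduced_kill. Qed.

Let T_build i (x : E i) : killed K x -> exists y : T i, valT y = x.
Proof. by move=> Kx; apply: coinduced_build => a /Kpi; apply: Kx. Qed.

Let D_square i (x : T i) : D i.+1 (D i x) = 0.
Proof. by apply: coinduced_val_inj; apply: d_square. Qed.

Let valT_eq0 i (x : T i) : valT x = 0 -> x = 0.
Proof. by move=> x0; apply: coinduced_val_inj. Qed.

(** When [Ext^1 (C, A)] is free of rank one over [C] and the other [Ext^i (C, A)]
    vanish, [Hom (C, E)] is a complex of injectives whose only cohomology is [C],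
    in degree 1. Its first map splits; dropping it and its image leaves an
    injective resolution of [C]. *)
Lemma injdim_le_quotient : injdim_le (C^o : lmodType C) N.
Proof.
have D0_inj : injective (D 0%N).
  move=> x y /eqP; rewrite -subr_eq0 -linearB => /eqP D0.
  apply/eqP; rewrite -subr_eq0; apply/eqP/valT_eq0/ext0; split=> //.
  by have := congr1 (@valT 1) D0; rewrite /valT coinduced_mapE.
have injT i : injective_module (T i) by apply: coinduced_injective.
have [rho rhoK] := @injT 0%N _ _ (D 0%N) idfun D0_inj.
pose F i : lmodType C := if i is j.+1 then T j.+2 else kernel rho.
have F0_proj (x : T 1%N) : x - D 0%N (rho x) \in kernel_mem rho.
  by apply/eqP; rewrite linearB rhoK subrr.
have D1_lin : linear (fun x : kernel rho => D 1%N (kernel_val x)).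
  by move=> c x y; rewrite -linearP.
pose D1L := GRing.isLinear.Build C _ _ _ _ D1_lin.
pose D1 : {linear kernel rho -> T 2} := HB.pack (fun x : kernel rho => D 1%N (kernel_val x)) D1L.
pose DF i : {linear F i -> F i.+1} :=
  if i is j.+1 return {linear F i -> F i.+1} then D j.+2 else D1.
have [z' z'E] := T_build z_cocycle.1.
pose z0 : kernel rho := Kernel (F0_proj z').
have e_lin : linear (fun c : C^o => (c : C) *: z0).
  by move=> a b c; rewrite scalerDl scalerA.
pose eL := GRing.isLinear.Build C _ _ _ _ e_lin.
pose eF : {linear C^o -> F 0%N} := HB.pack (fun c : C^o => (c : C) *: z0) eL.
exists F, eF, DF; split.
- case=> [|i]; last exact: injT.
  apply: (@kernel_injective _ _ _ rho (D 0%N)); first exact: rhoK.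
  exact: injT.
- move=> a b /eqP; rewrite -subr_eq0 -linearB /= => /eqP ab0.
  apply/eqP; rewrite -subr_eq0; apply/eqP; set c := _ - _ in ab0 *.
  have {ab0} cz : c *: z' = D 0%N (c *: rho z').
    apply/eqP; rewrite linearZ -subr_eq0 -scalerBr; apply/eqP.
    by have := congr1 (@kernel_val _ _ _ rho) ab0.
  suff /Kpi : K (sigma c) by rewrite sigmaK.
  apply: z_free; exists (valT (c *: rho z')) => //.
  by have := congr1 (@valT 1) cz; rewrite /valT coinduced_mapE -z'E => <-.
- move=> x; split=> [Dx|[c <-]]; last first.
    rewrite linearZ /=; suff -> : D 1%N (z' - D 0%N (rho z')) = 0 by rewrite scaler0.
    rewrite linearB D_square subr0; apply: valT_eq0.
    by rewrite /valT coinduced_mapE -/(valT z') z'E z_cocycle.2.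
  have dx : d 1%N (valT (kernel_val x)) = 0 by have := congr1 (@valT 2) Dx.
  have [s [y Ky yE]] := z_gen (conj (@T_killed _ _) dx).
  have [y' y'E] := T_build Ky.
  have xE : kernel_val x = pi s *: z' + D 0%N y'.
    apply: coinduced_val_inj; rewrite coinduced_valP coinduced_lift coinduced_mapE.
    by rewrite -!/(valT _) y'E yE z'E addrC subrK.
  exists (pi s); apply/val_inj => /=; rewrite xE.
  have /eqP : rho (kernel_val x) = 0 by apply: kernel_val0.
  rewrite xE linearP rhoK /= addrC addr_eq0 => /eqP ->.
  by rewrite linearN linearZ scalerBr.
- case=> [|i] x; split=> [Dx|[y <-]]; try exact: D_square.
    have dx : d 2%N (valT (x : T 2)) = 0 by have := congr1 (@valT 3) Dx.
    have [y Ky yE] := ext_ge2 (conj (@T_killed _ _) dx).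
    have [y' y'E] := T_build Ky; exists (Kernel (F0_proj y')).
    apply: coinduced_val_inj; rewrite [LHS](_ : _ = valT (D 1%N (y' - D 0%N (rho y')))) //.
    rewrite linearB D_square subr0.
    by rewrite [LHS](_ : _ = d 1%N (valT y')) // y'E yE.
  have dx : d i.+3 (valT (x : T i.+3)) = 0 by have := congr1 (@valT i.+4) Dx.
  have [y Ky yE] := ext_ge2 (conj (@T_killed _ _) dx).
  have [y' y'E] := T_build Ky; exists y'; apply: coinduced_val_inj.
  by rewrite [LHS](_ : _ = d i.+2 (valT y')) // y'E yE.
- by case=> [//|i] Ni x; apply: valT_eq0; apply: E_bound; apply: ltnW.
Qed.

End QuotientResolution.

(** * Gorenstein quotients of a Gorenstein local ring *)

Section Surjection.
Variables (A C : comPzRingType) (pi : {rmorphism A -> C}).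
Hypothesis pi_surj : forall c, exists a, pi a = c.

Lemma noetherian_surj : noetherian A -> noetherian C.
Proof.
move=> noethA L; have preim0 (M : ideal C) : M (pi 0) by rewrite rmorph0; apply: ideal0.
have preimD (M : ideal C) a b : M (pi a) -> M (pi b) -> M (pi (a + b)).
  by rewrite rmorphD; apply: idealD.
have preimM (M : ideal C) a b : M (pi b) -> M (pi (a * b)).
  by rewrite rmorphM; apply: idealMl.
pose preim (M : ideal C) := @Ideal A [set a | M (pi a)] (preim0 M) (@preimD M) (@preimM M).
have [s sE] := noetherian_adjoin noethA (preim L).
exists [seq pi a | a <- s]; rewrite gen_adjoin; apply/seteqP; split=> [c|].
  have [a <-] := pi_surj c => La; have : preim L a by [].
  rewrite sE; apply: (@adjoin_min _ _ (preim (adjoin (zero_ideal C) _))).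
    by move=> _ ->; apply: preim0.
  by move=> x xs; apply: adjoinr; apply: map_f.
apply: adjoin_min => [_ ->|_ /mapP[x xs ->]]; first exact: ideal0.
suff : preim L x by []; by rewrite sE; apply: adjoinr.
Qed.

(** The projectors [tau] and [tau'] make [A / J] and [A / J'] direct summands of [A]
    over [T], so that their Ext into [A] vanish. Then [J' = Hom (A / J, A)] is a
    canonical module of [A / J], which [psi] identifies with the ideal [K / J], and
    the quotient by a canonical ideal is Gorenstein. *)
Lemma gorenstein_linkage (m : ideal A) (T : set A) (J J' K : ideal A)
    (tau tau' psi : A -> A) :
  gorenstein A ->
  ~ m 1 -> (forall x, ~ m x -> exists y, y * x = 1) ->
  T 0 -> (forall x y, T x -> T y -> T (x + y)) ->
  (forall x y, T x -> T y -> T (x * y)) -> T `<=` m ->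
  (forall P, prime_ideal P -> T `<=` P -> m `<=` P) ->
  (forall x y, tau (x - y) = tau x - tau y) ->
  (forall r x, T r -> tau (r * x) = r * tau x) ->
  (forall x, tau (tau x) = tau x) -> (forall x, J x <-> tau x = 0) ->
  (forall x y, tau' (x - y) = tau' x - tau' y) ->
  (forall r x, T r -> tau' (r * x) = r * tau' x) ->
  (forall x, tau' (tau' x) = tau' x) -> (forall x, J' x <-> tau' x = 0) ->
  (forall a, K a <-> pi a = 0) -> J `<=` K ->
  (forall c k l, K k -> K l -> psi (c * k + l) = c * psi k + psi l) ->
  (forall k, K k -> psi k = 0 <-> J k) ->
  (forall u, J' u <-> exists2 k, K k & psi k = u) ->
  (forall a, (forall b, J b -> b * a = 0) -> J' a) ->
  (forall a, (forall b, J' b -> b * a = 0) -> J a) ->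
  (forall a, (forall b, K b -> b * a = 0) -> a = 0) ->
  gorenstein C.
Proof.
move=> [noethA [N [E [e [d [injE e_inj exact_e exact_d E_bound]]]]]].
move=> m1 m_unit T0 TD TM Tm Tprime tauB tauT tauK tauJ tauB' tauT' tauK' tauJ'.
move=> Kpi JK psiP psi_ker psi_im annJ annJ' annK.
have exJ i : ext_zero d J i.+1.
  exact: (@ext_zero_summand A E e d injE exact_e exact_d noethA N E_bound m m1
    m_unit T T0 TD TM Tm Tprime J tau).
have exJ' i : ext_zero d J' i.+1.
  exact: (@ext_zero_summand A E e d injE exact_e exact_d noethA N E_bound m m1
    m_unit T T0 TD TM Tm Tprime J' tau').
split; first exact: noetherian_surj.
pose sigma c := sval (cid (pi_surj c)).
have sigmaK : cancel sigma pi by move=> c; rewrite /sigma; case: cid.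
have [z [Zz z_free z_gen]] := linkage_ext1 injE e_inj exact_e exact_d JK psiP
  psi_ker psi_im annJ annJ' exJ exJ'.
exists N; apply: (injdim_le_quotient sigmaK injE _ E_bound Kpi _ Zz z_free z_gen) => //.
- by move=> i x; apply/exact_d; exists x.
- exact: (linkage_ext0 e_inj exact_e annK).
- exact: (linkage_ext_ge2 injE exact_d JK psiP psi_ker psi_im exJ exJ').
Qed.

End Surjection.

(** * Annihilators in a Cohen-Macaulay local ring *)

Section CohenMacaulay.
Variable A : comPzRingType.
Implicit Types (J P : ideal A) (s : seq A).
Hypothesis noethA : noetherian A.

Variable m : ideal A.
Hypothesis local_m : is_local_at m.

(** By Nakayama's lemma the elements killed by an associated prime [P] of [J] do
    not all lie in [J + (x)]; a prime associated to [J + (x)] that kills one of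
    the others contains [P] and [x]. *)
Lemma associated_prime_regular J x v : m x -> colon J x `<=` J -> max_colon J v ->
  exists2 w, max_colon (ideal_adjoin J x) w &
    colon J v `<=` colon (ideal_adjoin J x) w /\
    ~ (colon (ideal_adjoin J x) w `<=` colon J v).
Proof.
move=> mx JxJ [Jv maxv].
pose S : set A := [set n | forall p, colon J v p -> J (n * p)].
have S0 : S 0 by move=> p _; rewrite mul0r; apply: ideal0.
have SD a b : S a -> S b -> S (a + b).
  by move=> Sa Sb p vp; rewrite mulrDl; apply: idealD; [apply: Sa | apply: Sb].
have SM a b : S b -> S (a * b).
  by move=> Sb p vp; rewrite -mulrA; apply: idealMl; apply: Sb.
have [n Sn Jn] : exists2 n, S n & ~ ideal_adjoin J x n.
  apply: contrapT => noN; apply: Jv.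
  have [s sE] := noetherian_adjoin noethA (Ideal S0 SD SM).
  have sS a : S a <-> adjoin (zero_ideal A) s a by rewrite -sE.
  apply: (@nakayama A A^o J _ S x s _ _ _ _ v).
  - by move=> c a b Ja Jb; apply: idealD => //; apply: idealMl.
  - exact: (max_unit_1B (local_proper local_m) (local_unit noethA local_m)).
  - by move=> a as_; apply/sS; apply: adjoinr.
  - move=> a /sS/span_mod_adjoin; apply: span_modS => _ ->; exact: ideal0.
  - move=> a Sa; have [c Jac] : ideal_adjoin J x a.
      by apply: contrapT => Ja; apply: noN; exists a.
    exists c => [p vp|]; last by rewrite [_ *: _]mulrC.
    apply: JxJ => /=; rewrite mulrAC -[c * x](subKr a) mulrBl.
    by apply: idealB; [apply: Sa | rewrite mulrC; apply: idealMl].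
  - by move=> p /=; rewrite mulrC.
have [w maxw nw] := max_colon_above noethA Jn; exists w => //; split.
  move=> p vp; apply: nw => /=; apply: ideal_adjoinl; rewrite mulrC; exact: Sn.
move=> /(_ x) wv; have: colon J v x.
  apply: wv; apply: nw; have: ideal_adjoin J x (n * x).
    by apply: idealMl; apply: ideal_adjoinr.
  by rewrite mulrC.
by rewrite /= mulrC => /JxJ.
Qed.

(** One more prime for each element of the sequence. *)
Lemma prime_chain_regular J s v : regular_in m J s -> max_colon J v ->
  exists2 Q, prime_chain (size s) Q & Q 0%N = colon J v.
Proof.
elim: s J v => [|x s IHs] J v /=.
  move=> _ maxv; exists (fun=> colon J v) => //; split=> // i _.
  exact: max_colon_prime.
move=> [[mx JxJ] regs] maxv.
have [w maxw [vw wv]] := associated_prime_regular mx JxJ maxv.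
have [Q [Qprime Qlt] Q0] := IHs _ _ regs maxw.
exists (fun i => if i is j.+1 then Q j else colon J v) => //; split.
  by case=> [_|i]; [apply: max_colon_prime | apply: Qprime].
by case=> [_|i]; [rewrite Q0 | apply: Qlt].
Qed.

End CohenMacaulay.

(** An associated prime containing [I] would have height at least 1 and would
    begin a chain of primes as long as the depth. *)
Lemma cohen_macaulay_annihilator (A : comPzRingType) (I : ideal A) :
  local_cohen_macaulay A -> codim_ge I 1 ->
  forall z, (forall a, I a -> a * z = 0) -> z = 0.
Proof.
move=> [noethA [m [d [local_m [_ dim_d] [[s [sd sm [_ regs]]] _]]]]] codimI z Iz.
apply: contrapT => z0.
have [v maxv zv] := max_colon_above noethA (J := zero_ideal A) z0.
have [Q [Qprime Qlt] Q1] := codimI _ (max_colon_prime maxv) (fun a Ia => zv a (Iz a Ia)).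
have [||P [Pprime Plt] P0] := @prime_chain_regular A noethA m local_m (zero_ideal A) s v.
- apply: regular_in_nth => // i si y; rewrite -!gen_adjoin; exact: regs.
- exact: maxv.
suff: (d.+1 <= d)%N by rewrite ltnn.
apply: dim_d; exists (fun i => if i is j.+1 then P j else Q 0%N); split.
  by case=> [_|i]; [apply: Qprime | rewrite ltnS -sd; apply: Pprime].
case=> [_|i]; last by rewrite ltnS -sd; apply: Plt.
by rewrite P0 -Q1; apply: Qlt.
Qed.

(** * Truncated Rees rings *)


(** ** Components *)

Section QuotientLift.
Variables (A C : comPzRingType) (I : ideal A) (f : {rmorphism A -> C}).
Hypothesis f0 : forall x, I x -> f x = 0.

Definition quo_lift (_ : forall x, I x -> f x = 0) (u : quo I) : C := f (repr u).

Lemma quo_lift_pi x : quo_lift f0 (quo_pi I x) = f x.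
Proof.
apply/eqP; rewrite -subr_eq0 -rmorphB; apply/eqP; apply: f0.
by apply/quo_piE; rewrite /quo_pi reprK.
Qed.

Fact quo_lift_zmod_morphism : zmod_morphism (quo_lift f0).
Proof.
move=> u v; have [[x <-] [y <-]] := (quo_pi_surj u, quo_pi_surj v).
by rewrite -quo_piB !quo_lift_pi rmorphB.
Qed.

Fact quo_lift_monoid_morphism : monoid_morphism (quo_lift f0).
Proof.
split=> [|u v]; first by rewrite [LHS](quo_lift_pi 1) rmorph1.
have [[x <-] [y <-]] := (quo_pi_surj u, quo_pi_surj v).
by rewrite -rmorphM !quo_lift_pi rmorphM.
Qed.

HB.instance Definition _ := GRing.isZmodMorphism.Build _ _ (quo_lift f0)
  quo_lift_zmod_morphism.
HB.instance Definition _ := GRing.isMonoidMorphism.Build _ _ (quo_lift f0)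
  quo_lift_monoid_morphism.

End QuotientLift.

Section TruncatedRees.
Variables (R : comNzRingType) (I : ideal R) (n : nat).
Local Notation S := (truncated_rees I n.+1).
Implicit Types (u v : S) (p : rees I) (i j k q : nat).

Lemma ideal_powS k x : ideal_pow I k.+1 x -> ideal_pow I k x.
Proof.
move=> [s sI ->]; rewrite big_seq; elim/big_ind: _ => [| |p /sI[_]].
- exact: ideal0.
- by move=> *; apply: idealD.
- exact: idealMl.
Qed.

Lemma ideal_pow_annihilator k z :
  (forall x, (forall a, I a -> a * x = 0) -> x = 0) ->
  (forall a, ideal_pow I k a -> a * z = 0) -> z = 0.
Proof.
move=> annI; elim: k z => [|k IHk] z kz; first by rewrite -[z]mul1r kz.
apply: annI => a Ia; apply: IHk => b kb; rewrite mulrA mulrC.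
rewrite [b * a]mulrC mulrC; apply: kz; exists [:: (a, b)]; last by rewrite big_seq1.
by move=> _ /[!inE] /eqP ->.
Qed.

Definition coef u j : R := (rees_poly (repr u))`_j.

Lemma coef_pi p j : (j <= n)%N -> coef (quo_pi (rees_ge I n.+1) p) j = (rees_poly p)`_j.
Proof.
move=> jn; apply/eqP; rewrite -subr_eq0 -coefB; apply/eqP.
have: rees_ge I n.+1 (repr (quo_pi (rees_ge I n.+1) p) - p).
  by apply/quo_piE; rewrite /quo_pi reprK.
exact.
Qed.

Lemma coefP u v : (forall j, (j <= n)%N -> coef u j = coef v j) -> u = v.
Proof.
move: (quo_pi_surj u) (quo_pi_surj v) => [p <-] [q <-] uv.
apply/quo_piE => j jn; rewrite coefB; have := uv j jn; rewrite !coef_pi // => ->.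
exact: subrr.
Qed.

Lemma coef_pow u j : ideal_pow I j (coef u j).
Proof. by have /rees_memP := rees_polyP (repr u). Qed.

Lemma coefsB u v j : (j <= n)%N -> coef (u - v) j = coef u j - coef v j.
Proof.
move: (quo_pi_surj u) (quo_pi_surj v) => [p <-] [q <-] jn.
by rewrite -quo_piB !coef_pi // coefB.
Qed.

Lemma coefs0 j : (j <= n)%N -> coef 0 j = 0.
Proof. by move=> jn; rewrite -(subrr 0) coefsB // subrr. Qed.

Lemma coefsD u v j : (j <= n)%N -> coef (u + v) j = coef u j + coef v j.
Proof.
move: (quo_pi_surj u) (quo_pi_surj v) => [p <-] [q <-] jn.
by rewrite -quo_piD !coef_pi // coefD.
Qed.

Lemma coefs1 j : (j <= n)%N -> coef 1 j = (j == 0%N)%:R.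
Proof. by move=> jn; rewrite [LHS](@coef_pi 1) // coef1. Qed.

Lemma coefsM u v j : (j <= n)%N ->
  coef (u * v) j = \sum_(i < j.+1) coef u (j - i) * coef v i.
Proof.
move: (quo_pi_surj u) (quo_pi_surj v) => [p <-] [q <-] jn.
rewrite -rmorphM coef_pi // coefMr; apply: eq_bigr => i _.
have ij : (i <= j)%N by rewrite -ltnS.
by rewrite !coef_pi // (leq_trans _ jn) // leq_subr.
Qed.

Definition trunc (f : nat -> R) : S :=
  quo_pi (rees_ge I n.+1) (insubd (0 : rees I) (\poly_(j < n.+1) f j)).

Lemma coef_trunc f j : (forall j, (j <= n)%N -> ideal_pow I j (f j)) ->
  (j <= n)%N -> coef (trunc f) j = f j.
Proof.
move=> fI jn; rewrite coef_pi // insubdK ?coef_poly ?ltnS ?jn //.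
apply/rees_memP => i; rewrite coef_poly ltnS; case: ifP => [/fI //|_].
exact: ideal0.
Qed.

Definition monom k x : S := trunc (fun j => if j == k then x else 0).

Lemma coef_monom k x j : ideal_pow I k x -> (j <= n)%N ->
  coef (monom k x) j = if j == k then x else 0.
Proof.
move=> kx jn; rewrite coef_trunc // => i _.
by case: eqP => [->|_] //; apply: ideal0.
Qed.

Lemma coef_monomM k x u j : ideal_pow I k x -> (k + j <= n)%N ->
  coef (monom k x * u) (k + j) = x * coef u j.
Proof.
move=> kx kjn; rewrite coefsM //.
have jkj : (j < (k + j).+1)%N by rewrite ltnS leq_addl.
rewrite (bigD1 (Ordinal jkj)) //= big1 ?addr0 => [|i ij]; last first.
  rewrite coef_monom // ?(leq_trans (leq_subr _ _)) //; case: eqP => [kE|_]; last by rewrite mul0r.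
  case/eqP: ij; apply/val_inj => /=; apply/eqP; rewrite -(eqn_add2l k) -{1}kE subnK //.
  by rewrite -ltnS.
by rewrite addnK coef_monom ?eqxx // (leq_trans _ kjn) // leq_addr.
Qed.

Lemma coef_monomM0 k x u j : ideal_pow I k x -> (j <= n)%N -> (j < k)%N ->
  coef (monom k x * u) j = 0.
Proof.
move=> kx jn jk; rewrite coefsM // big1 // => i _.
rewrite coef_monom // ?(leq_trans (leq_subr _ _)) //.
by rewrite ltn_eqF ?mul0r // (leq_ltn_trans (leq_subr _ _)).
Qed.

Local Notation const := (monom 0).

Lemma coef_constM x u j : (j <= n)%N -> coef (const x * u) j = x * coef u j.
Proof. exact: (@coef_monomM 0). Qed.

Lemma coef_const x : coef (const x) 0 = x.
Proof. by rewrite coef_monom. Qed.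

Program Definition tail q : ideal S :=
  @Ideal S [set u | forall j, (j <= n)%N -> (j < q)%N -> coef u j = 0] _ _ _.
Next Obligation. by move=> q j jn _; rewrite coefs0. Qed.
Next Obligation. by move=> q u v uq vq j jn jq; rewrite coefsD // uq // vq // addr0. Qed.
Next Obligation.
move=> q a u uq j jn jq; rewrite coefsM // big1 // => -[i /=]; rewrite ltnS => ij _.
by rewrite uq ?mulr0 ?(leq_trans ij) // (leq_ltn_trans ij).
Qed.

Definition head q u : S := trunc (fun j => if (j < q)%N then coef u j else 0).

Lemma coef_head q u j : (j <= n)%N ->
  coef (head q u) j = if (j < q)%N then coef u j else 0.
Proof.
move=> jn; rewrite coef_trunc // => i _.
by case: ifP => _; [apply: coef_pow | apply: ideal0].
Qed.

Lemma headB q u v : head q (u - v) = head q u - head q v.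
Proof.
apply: coefP => j jn; rewrite coefsB // !coef_head //.
by case: ifP => _; rewrite ?subr0 // coefsB.
Qed.

Lemma head_constM q x u : head q (const x * u) = const x * head q u.
Proof.
apply: coefP => j jn; rewrite coef_constM // !coef_head // coef_constM //.
by case: ifP; rewrite ?mulr0.
Qed.

Lemma headK q u : head q (head q u) = head q u.
Proof. by apply: coefP => j jn; rewrite !coef_head //; case: (j < q)%N. Qed.

Lemma tail_head q u : tail q u <-> head q u = 0.
Proof.
split=> [uq|u0 j jn jq].
  by apply: coefP => j jn; rewrite coef_head // coefs0 //; case: ifP => // /uq->.
by have := congr1 (coef^~ j) u0; rewrite /= coef_head // jq coefs0.
Qed.

Lemma tail_nilpotent u : tail 1 u -> u ^+ n.+1 = 0.
Proof.
move=> u1; have uk k : tail k (u ^+ k); last first.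
  by apply: coefP => j jn; rewrite uk ?coefs0.
elim: k => [|k IHk] j jn //; rewrite exprSr coefsM // ltnS => jk.
rewrite big1 // => -[[|i] /= ij] _; first by rewrite (u1 0%N) ?mulr0.
rewrite IHk ?mul0r ?(leq_trans (leq_subr _ _)) //.
by apply: leq_trans jk; rewrite ltn_subrL /=; move: ij; case: (j).
Qed.

(** ** The local ring structure *)

Variable m : ideal R.
Hypothesis m_proper : ~ m 1.
Hypothesis m_unit : forall x, ~ m x -> exists y, y * x = 1.

Program Definition trunc_max : ideal S := @Ideal S [set u | m (coef u 0)] _ _ _.
Next Obligation. by rewrite /= coefs0 //; apply: ideal0. Qed.
Next Obligation. by move=> u v /= mu mv; rewrite coefsD //; apply: idealD. Qed.
Next Obligation.
by move=> u v /= mv; rewrite coefsM // big_ord1 /=; apply: idealMl.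
Qed.

Definition max_consts : set S := [set const x | x in m].

Lemma trunc_max_proper : ~ trunc_max 1.
Proof. by rewrite /= coefs1. Qed.

Lemma trunc_max_unit u : ~ trunc_max u -> exists v, v * u = 1.
Proof.
move=> /m_unit[x xu]; pose w := 1 - const x * u.
have w_nil : w ^+ n.+1 = 0.
  apply: tail_nilpotent => -[|//] _ _.
  by rewrite coefsB // coefs1 // coef_constM // xu subrr.
exists ((\sum_(i < n.+1) w ^+ i) * const x).
rewrite -mulrA mulrC -[const x * u](subKr 1) -/w -opprB mulNr -subrX1 w_nil.
by rewrite sub0r opprK.
Qed.

Lemma max_consts0 : max_consts 0.
Proof.
exists 0; first exact: ideal0.
by apply: coefP => j jn; rewrite coef_monom // coefs0 // if_same.
Qed.

Lemma max_constsD u v : max_consts u -> max_consts v -> max_consts (u + v).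
Proof.
move=> [x mx <-] [y my <-]; exists (x + y); first exact: idealD.
apply: coefP => j jn; rewrite coefsD // !coef_monom //.
by case: ifP; rewrite ?addr0.
Qed.

Lemma max_constsM u v : max_consts u -> max_consts v -> max_consts (u * v).
Proof.
move=> [x mx <-] [y my <-]; exists (x * y); first exact: idealMl.
apply: coefP => j jn; rewrite coef_constM // !coef_monom //.
by case: ifP; rewrite ?mulr0.
Qed.

Lemma max_consts_max : max_consts `<=` trunc_max.
Proof. by move=> _ [x mx <-] /=; rewrite coef_const. Qed.

(** An element of the maximal ideal is a constant plus a nilpotent element. *)
Lemma max_consts_prime (P : ideal S) :
  prime_ideal P -> max_consts `<=` P -> trunc_max `<=` P.
Proof.
move=> [P1 PM] mP u mu; pose w := u - const (coef u 0).
have w1 : tail 1 w by move=> [|//] _ _; rewrite coefsB // coef_const subrr.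
rewrite -(subrK (const (coef u 0)) u); apply: idealD; last by apply: mP; exists (coef u 0).
have: P (w ^+ n.+1) by rewrite tail_nilpotent //; apply: ideal0.
have Pw k : P (w ^+ k) -> P w.
  by elim: k => [|k IHk]; [rewrite expr0 => /P1 | rewrite exprS => /PM[]].
exact: Pw.
Qed.

(** ** Annihilators *)

Hypothesis annI : forall x, (forall a, I a -> a * x = 0) -> x = 0.

Lemma const_annihilator k u : (forall x, ideal_pow I k x -> const x * u = 0) -> u = 0.
Proof.
move=> ku; apply: coefP => j jn; rewrite coefs0 //.
apply: (ideal_pow_annihilator (k := k) annI) => a ka.
by rewrite -coef_constM // ku // coefs0.
Qed.

Lemma tail_annihilator k u : (k <= n)%N ->
  (forall v, tail k v -> v * u = 0) -> tail (n - k).+1 u.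
Proof.
move=> kn ku j jn; rewrite ltnS => jk.
apply: (ideal_pow_annihilator (k := k) annI) => a ka.
have kj : (k + j <= n)%N by rewrite -leq_subRL.
rewrite -(coef_monomM u ka kj) ku ?coefs0 // => i i_n ik.
by rewrite coef_monom // ltn_eqF.
Qed.


Lemma gorenstein_truncated_quotient (C : comPzRingType) (pi : {rmorphism S -> C})
    (q q' : nat) (K : ideal S) (psi : S -> S) :
  gorenstein S -> (q + q' = n.+1)%N -> (0 < q)%N -> (0 < q')%N ->
  (forall c, exists a, pi a = c) -> (forall a, K a <-> pi a = 0) ->
  tail q `<=` K ->
  (forall c u v, K u -> K v -> psi (c * u + v) = c * psi u + psi v) ->
  (forall u, K u -> psi u = 0 <-> tail q u) ->
  (forall u, tail q' u <-> exists2 v, K v & psi v = u) ->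
  (forall a, (forall b, K b -> b * a = 0) -> a = 0) ->
  gorenstein C.
Proof.
move=> gorS qq' q_gt0 q'_gt0 pi_surj Kpi JK psiP psi_ker psi_im annK.
have head_max k x u : max_consts x -> head k (x * u) = x * head k u.
  by move=> [y _ <-]; apply: head_constM.
have tail_ann k k' : (k + k' = n.+1)%N -> (0 < k')%N ->
    forall u, (forall v, tail k v -> v * u = 0) -> tail k' u.
  move=> kk' k'_gt0 u; have kn : (k <= n)%N by rewrite -ltnS -kk' -addn1 leq_add2l.
  move/(tail_annihilator kn); suff -> : (n - k).+1 = k' by [].
  by rewrite -subSn // -kk' addKn.
apply: (gorenstein_linkage pi_surj gorS trunc_max_proper trunc_max_unit max_consts0
  max_constsD max_constsM max_consts_max max_consts_prime (headB q) (head_max q)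
  (headK q) (tail_head q) (headB q') (head_max q') (headK q') (tail_head q') Kpi JK
  psiP psi_ker psi_im _ _ annK); first exact: tail_ann.
by apply: tail_ann => //; rewrite addnC.
Qed.

(** ** The associated graded ring *)

(** The kernel of the projection onto the truncated associated graded ring. Its
    first [n] components are those of [I R(I)], a copy of the components of
    positive degree of [S]: this makes it canonical modulo [tail n]. *)
Program Definition shift_kernel : ideal S :=
  @Ideal S [set u | forall j, (j < n)%N -> ideal_pow I j.+1 (coef u j)] _ _ _.
Next Obligation. by move=> j jn; rewrite coefs0 1?ltnW //; apply: ideal0. Qed.
Next Obligation.
by move=> u v uI vI j jn; rewrite coefsD 1?ltnW //; apply: idealD; [apply: uI | apply: vI].
Qed.
Next Obligation.
move=> a u uI j jn; rewrite coefsM 1?ltnW //; apply: ideal_sum => i.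
have ij : (i <= j)%N by rewrite -ltnS.
rewrite -{1}(subnK ij) -addnS; apply: ideal_powM.
  exact: coef_pow.
by apply: uI; apply: leq_ltn_trans jn.
Qed.

Definition degree_shift u : S := trunc (fun j => if j is i.+1 then coef u i else 0).

Lemma coef_shift0 u : shift_kernel u -> coef (degree_shift u) 0 = 0.
Proof.
move=> uI; rewrite coef_trunc // => -[|j] jn; [exact: ideal0 | exact: uI].
Qed.

Lemma coef_shiftS u j : shift_kernel u -> (j < n)%N -> coef (degree_shift u) j.+1 = coef u j.
Proof.
move=> uI jn; rewrite coef_trunc // => -[|i] i_n; [exact: ideal0 | exact: uI].
Qed.

Lemma degree_shiftP c u v : shift_kernel u -> shift_kernel v ->
  degree_shift (c * u + v) = c * degree_shift u + degree_shift v.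
Proof.
move=> uI vI; have cuv : shift_kernel (c * u + v) by apply: idealD => //; apply: idealMl.
apply: coefP => -[_|j jn].
  by rewrite coefsD // coefsM // big_ord1 !coef_shift0 // mulr0 addr0.
rewrite coefsD // coefsM // big_ord_recl /= !coef_shift0 // mulr0 add0r.
rewrite !coef_shiftS // coefsD 1?ltnW // coefsM 1?ltnW //; congr (_ + _).
apply: eq_bigr => i _; rewrite coef_shiftS ?subSS //.
by rewrite (leq_ltn_trans _ jn) // -ltnS.
Qed.

Lemma degree_shift_eq0 u : shift_kernel u -> degree_shift u = 0 <-> tail n u.
Proof.
move=> uI; split=> [u0 j _ jn|un].
  by rewrite -coef_shiftS // u0 coefs0.
apply: coefP => -[_|j jn]; rewrite coefs0 //; first by rewrite coef_shift0.
by rewrite coef_shiftS // un // ltnW.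
Qed.

Lemma degree_shift_image u : tail 1 u <-> exists2 v, shift_kernel v & degree_shift v = u.
Proof.
split=> [u1|[v vI <-] [|//] _ _]; last by rewrite coef_shift0.
pose v := trunc (fun j => if (j < n)%N then coef u j.+1 else 0).
have vE j : (j < n)%N -> coef v j = coef u j.+1.
  move=> jn; rewrite coef_trunc ?jn // 1?ltnW // => i _.
  by case: ifP => _; [apply: ideal_powS; apply: coef_pow | apply: ideal0].
have vI : shift_kernel v by move=> j jn; rewrite vE //; apply: coef_pow.
exists v => //; apply: coefP => -[_|j jn]; first by rewrite coef_shift0 // u1.
by rewrite coef_shiftS // vE.
Qed.

Lemma shift_kernel_annihilator u : (forall v, shift_kernel v -> v * u = 0) -> u = 0.
Proof.
move=> uK; apply: (@const_annihilator 1) => x [s sI ->].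
apply: uK => j jn; rewrite coef_monom // 1?ltnW //; case: j jn => [_|j _].
  by exists s.
exact: (ideal0 (ideal_pow I j.+2)).
Qed.

(** The components of degree at least [n] of [p] form an element of
    [rees_ge I n], so they can be dropped. *)
Lemma rees_to_gr_eq0 (p : rees I) :
  quo_pi (gr_ge I n) (quo_pi (rees_shift I) p) = 0 <->
  forall j, (j < n)%N -> ideal_pow I j.+1 (rees_poly p)`_j.
Proof.
rewrite -[X in _ = X](rmorph0 (quo_pi (gr_ge I n))) quo_piE subr0; split.
  move=> [q qn /quo_piE pq] j jn.
  by have := pq j; rewrite coefB qn // sub0r => /idealN; rewrite opprK.
move=> pI; have qmem : \poly_(j < size (rees_poly p)) (if (j < n)%N then 0 else (rees_poly p)`_j) \in rees_mem I.
  apply/rees_memP => j; rewrite coef_poly; case: ifP => _; last exact: ideal0.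
  by case: ifP => _; [apply: ideal0 | have /rees_memP := rees_polyP p].
exists (ReesElt qmem) => [j jn|]; first by rewrite coef_poly jn if_same.
apply/quo_piE => j; rewrite coefB coef_poly.
case: ifP => [_|/negbT]; last first.
  by rewrite -leqNgt => /leq_sizeP -> //; rewrite subrr; apply: ideal0.
case: ifP => [jn|_]; last by rewrite subrr; apply: ideal0.
by rewrite sub0r; apply: idealN; apply: pI.
Qed.

Lemma gorenstein_truncated_gr : (0 < n)%N -> gorenstein S -> gorenstein (truncated_gr I n).
Proof.
move=> n_gt0 gorS; pose f : {rmorphism rees I -> truncated_gr I n} :=
  (quo_pi (gr_ge I n) \o quo_pi (rees_shift I)).
have f0 p : rees_ge I n.+1 p -> f p = 0.
  move=> p0; apply/rees_to_gr_eq0 => j jn; rewrite p0 1?ltnW //; exact: ideal0.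
apply: (@gorenstein_truncated_quotient _ (quo_lift f0) n 1 shift_kernel degree_shift) => //.
- by rewrite addn1.
- move=> c; have [b <-] := quo_pi_surj c; have [p <-] := quo_pi_surj b.
  by exists (quo_pi _ p); apply: (quo_lift_pi f0).
- move=> u; have [p <-] := quo_pi_surj u; rewrite [X in _ <-> X = _](quo_lift_pi f0).
  rewrite rees_to_gr_eq0; split=> pI j jn; last by rewrite coef_pi 1?ltnW //; apply: pI.
  by have := pI j jn; rewrite coef_pi 1?ltnW.
- by move=> u un j jn; rewrite (un j (ltnW jn) jn); apply: ideal0.
- exact: degree_shiftP.
- exact: degree_shift_eq0.
- exact: degree_shift_image.
- exact: shift_kernel_annihilator.
Qed.

(** ** The quotient by the power *)

(** Modulo [tail 1] this is [I^n], the top component of [S]. *)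
Program Definition pow_kernel : ideal S :=
  @Ideal S [set u | ideal_pow I n (coef u 0)] _ _ _.
Next Obligation. by rewrite /= coefs0 //; apply: ideal0. Qed.
Next Obligation. by move=> u v /= uI vI; rewrite coefsD //; apply: idealD. Qed.
Next Obligation. by move=> a u /= uI; rewrite coefsM // big_ord1; apply: idealMl. Qed.

Definition to_top u : S := monom n (coef u 0).

Lemma coef_to_top u j : pow_kernel u -> (j <= n)%N ->
  coef (to_top u) j = if j == n then coef u 0 else 0.
Proof. exact: coef_monom. Qed.

Lemma to_topP c u v : pow_kernel u -> pow_kernel v ->
  to_top (c * u + v) = c * to_top u + to_top v.
Proof.
move=> uI vI; have cuv : pow_kernel (c * u + v) by apply: idealD => //; apply: idealMl.
apply: coefP => j jn; rewrite [RHS]coefsD // !coef_to_top // [c * to_top u]mulrC.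
case: eqP => [->|/eqP j_n]; last by rewrite coef_monomM0 ?addr0 // ltn_neqAle j_n.
rewrite coefsD // coefsM // big_ord1; congr (_ + _).
by have := @coef_monomM n _ c 0 uI; rewrite addn0 => cE; rewrite [RHS]cE // mulrC.
Qed.

Lemma to_top_eq0 u : pow_kernel u -> to_top u = 0 <-> tail 1 u.
Proof.
move=> uI; split=> [u0 [|//] _ _|u1]; last first.
  by apply: coefP => j jn; rewrite coef_to_top // coefs0 // u1 // if_same.
by have := coef_to_top uI (leqnn n); rewrite u0 coefs0 // eqxx.
Qed.

Lemma to_top_image u : tail n u <-> exists2 v, pow_kernel v & to_top v = u.
Proof.
split=> [un|[v vI <-] j jn j_n]; last by rewrite coef_to_top // ltn_eqF.
exists (const (coef u n)); first by rewrite /= coef_const; apply: coef_pow.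
apply: coefP => j jn; rewrite coef_to_top //= coef_const; last exact: coef_pow.
by case: eqP => [-> //|/eqP j_n]; rewrite un // ltn_neqAle j_n.
Qed.

Lemma pow_kernel_annihilator u : (forall v, pow_kernel v -> v * u = 0) -> u = 0.
Proof.
move=> uK; apply: (@const_annihilator n) => x xI.
by apply: uK; rewrite /= coef_const.
Qed.

Lemma gorenstein_quo_pow : (0 < n)%N -> gorenstein S -> gorenstein (quo (ideal_pow I n)).
Proof.
move=> n_gt0 gorS; pose f0 (p : rees I) := quo_pi (ideal_pow I n) (rees_poly p)`_0.
have f_zmod : zmod_morphism f0 by move=> p q; rewrite /f0 coefB rmorphB.
have f_monoid : monoid_morphism f0.
  by split=> [|p q]; rewrite /f0 ?coef1 ?rmorph1 // coef0M rmorphM.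
pose f : {rmorphism rees I -> quo (ideal_pow I n)} := HB.pack f0
  (GRing.isZmodMorphism.Build _ _ f0 f_zmod) (GRing.isMonoidMorphism.Build _ _ f0 f_monoid).
have fK p : rees_ge I n.+1 p -> f p = 0.
  by move=> p0; rewrite /= /f0 p0 // rmorph0.
apply: (@gorenstein_truncated_quotient _ (quo_lift fK) 1 n pow_kernel to_top) => //.
- move=> c; have [x <-] := quo_pi_surj c; exists (const x).
  by rewrite -[in RHS](coef_const x).
- move=> u; rewrite [X in _ <-> X = _](_ : _ = quo_pi (ideal_pow I n) (coef u 0)) //.
  by rewrite -[X in _ = X](rmorph0 (quo_pi (ideal_pow I n))) quo_piE subr0.
- by move=> u u1; rewrite /= u1 //; apply: ideal0.
- exact: to_topP.
- exact: to_top_eq0.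
- exact: to_top_image.
- exact: pow_kernel_annihilator.
Qed.

End TruncatedRees.

Theorem proposition5p2 (R : comNzRingType) (I : ideal R) (t : nat) :
  local_cohen_macaulay R ->
  codim_ge I 1 ->
  gorenstein (truncated_rees I t.+2) ->
  gorenstein (truncated_gr I t.+1) /\ gorenstein (quo (ideal_pow I t.+1)).
Proof.
move=> cmR codimI gorS; have annI := cohen_macaulay_annihilator cmR codimI.
have [noethR [m [_ [local_m _ _]]]] := cmR.
have m_proper := local_proper local_m; have m_unit := local_unit noethR local_m.
split; first exact: (gorenstein_truncated_gr m_proper m_unit annI).
exact: (gorenstein_quo_pow m_proper m_unit annI).
Qed.
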